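(* Let $R$ be a (commutative) integral domain. The following assertions are equivalent: 1) $\displaystyle \mathrm{TA}_2(R)=\bigcap_{\mathfrak{p}\in\mathrm{Spec}(R)}\mathrm{TA}_2(R_{\mathfrak{p}})$; 2) every locally free $R$-module of rank $1$ that can be generated by $2$ elements is free.
   Context: For a commutative ring $R$, $\mathrm{GA}_2(R)$ denotes the group of $R$-automorphisms of the polynomial ring $R[X,Y]$; an element is written $F=(F_1,F_2)$ with $F_1,F_2\in R[X,Y]$ the images of $X,Y$. An automorphism $F=(F_1,F_2)$ is affine if $\deg F_1=\deg F_2=1$ or, more generally, both components have total degree at most $1$; it is triangular if $F_1\in R[X,Y]$ and $F_2\in R[Y]$. $\mathrm{TA}_2(R)$ is the subgroup of $\mathrm{GA}_2(R)$ generated by affine and triangular automorphisms; its elements are called tame. For a domain $R$ with field of fractions $K(R)$ and $\mathfrak{p}\in\mathrm{Spec}(R)$, the localization $R_{\mathfrak{p}}$ is viewed as a subring of $K(R)$, and all the groups $\mathrm{TA}_2(R)$, $\mathrm{TA}_2(R_{\mathfrak{p}})$ are viewed as subgroups of $\mathrm{GA}_2(K(R))$, where the intersection is taken. An $R$-module $M$ is locally free of rank $1$ if $M_{\mathfrak p}\cong R_{\mathfrak p}$ for every $\mathfrak p\in\mathrm{Spec}(R)$ (for finitely generated $M$ over a domain). *)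

(* Defs.v *)
From HB Require Import structures.
From mathcomp Require Import all_boot all_algebra.
From mathcomp Require Import generic_quotient ring_quotient.
From mathcomp Require Import boolp mpoly ring.

Set Implicit Arguments.
Unset Strict Implicit.
Unset Printing Implicit Defensive.

Import GRing.Theory.

Local Open Scope ring_scope.
Local Open Scope quotient_scope.

(* R[X, Y] is {mpoly R[2]} with X = 'X_ord0 and Y = 'X_ord_max.  A pair
   F = (F1, F2) stands for the R-algebra endomorphism P |-> P(F1, F2) of
   R[X, Y], which maps X to F1 and Y to F2. *)
Section PolynomialAutomorphisms.
Variable R : comNzRingType.
Implicit Types F G : 2.-tuple {mpoly R[2]}.

Definition endo F : {mpoly R[2]} -> {mpoly R[2]} := comp_mpoly F.

(* Every R-algebra endomorphism of R[X, Y] is of this form. *)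
Lemma lrmorphism_endo (f : {lrmorphism {mpoly R[2]} -> {mpoly R[2]}}) :
  f =1 endo [tuple f 'X_i | i < 2].
Proof.
move=> P; rewrite /endo comp_mpolyE {1}(mpolyE P) linear_sum /=.
apply: eq_bigr => m _; rewrite linearZ /=; congr (_ *: _).
rewrite mpolyXE_id rmorph_prod /=; apply: eq_bigr => i _.
by rewrite rmorphXn /= tnth_mktuple.
Qed.

Definition GA2 F : Prop := bijective (endo F).

Definition endo_id : 2.-tuple {mpoly R[2]} := [tuple 'X_i | i < 2].

Definition endo_comp F G : 2.-tuple {mpoly R[2]} :=
  [tuple endo F (tnth G i) | i < 2].

Lemma endo_idE : endo endo_id =1 id.
Proof. exact: comp_mpoly_id. Qed.

Lemma endo_compE F G : endo (endo_comp F G) =1 endo F \o endo G.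
Proof.
move=> P /=; rewrite [endo G P]comp_mpolyE /endo comp_mpolyE rmorph_sum /=.
apply: eq_bigr => m _; rewrite comp_mpolyZ rmorph_prod /=; congr (_ *: _).
by apply: eq_bigr => i _; rewrite rmorphXn /= tnth_mktuple.
Qed.

(* msize is the total degree plus one (and 0 for the zero polynomial). *)
Definition affine F : Prop := forall i, (msize (tnth F i) <= 2)%N.

(* F2 belongs to R[Y]: the exponent of X vanishes in all its monomials. *)
Definition triangular F : Prop :=
  forall m, m \in msupp (tnth F ord_max) -> m ord0 = 0%N.

(* The subgroup of GA2 generated by affine and triangular automorphisms. *)
Inductive TA2 : 2.-tuple {mpoly R[2]} -> Prop :=
| TA2_affine F : GA2 F -> affine F -> TA2 F
| TA2_triangular F : GA2 F -> triangular F -> TA2 F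
| TA2_id : TA2 endo_id
| TA2_comp F G : TA2 F -> TA2 G -> TA2 (endo_comp F G)
| TA2_inv F G : TA2 F -> endo_comp F G = endo_id -> endo_comp G F = endo_id ->
    TA2 G.

End PolynomialAutomorphisms.

(* The image of TA2(A) under extension of scalars along f : A -> B; for f
   injective this is TA2(A) viewed inside GA2(B). *)
Definition TA2_image (A B : comNzRingType) (f : {rmorphism A -> B})
    (F : 2.-tuple {mpoly B[2]}) : Prop :=
  exists2 G : 2.-tuple {mpoly A[2]}, TA2 G & F = [tuple of map (map_mpoly f) G].

(* The library's prime ideals (proper by definition) are boolean predicates;
   under the classical axioms of boolp every subset of R is one, so that
   prime_idealr R is all of Spec R. *)
Section LocalizationOfDomain.
Variables (R : idomainType) (p : prime_idealr R).

Lemma notin_prime1 : 1 \notin p.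
Proof. by rewrite idealr1. Qed.

Lemma notin_primeM s t : s \notin p -> t \notin p -> s * t \notin p.
Proof. by move=> sp tp; rewrite prime_idealrM negb_or sp. Qed.

Lemma notin_prime_neq0 s : s \notin p -> s != 0.
Proof. by apply: contraNneq => ->; exact: idealr0. Qed.

Definition at_prime_pred : {pred {fraction R}} :=
  fun x => `[< exists a s : R, s \notin p /\ x = tofrac a / tofrac s >].

Lemma at_primeP x :
  reflect (exists a s : R, s \notin p /\ x = tofrac a / tofrac s)
          (x \in at_prime_pred).
Proof. exact: asboolP. Qed.

Lemma at_prime_subring : subring_closed at_prime_pred.
Proof.
have nz s : s \notin p -> tofrac s != 0 :> {fraction R}.
  by move=> /notin_prime_neq0; rewrite tofrac_eq0.
split.
- apply/at_primeP; exists 1, 1; split; first exact: notin_prime1.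
  by rewrite tofrac1 divr1.
- move=> _ _ /at_primeP[a [s [sp ->]]] /at_primeP[b [t [tp ->]]].
  apply/at_primeP; exists (a * t - b * s), (s * t); split.
    exact: notin_primeM.
  rewrite -mulNr addf_div ?nz // tofracM tofracB !tofracM.
  by rewrite mulNr.
- move=> _ _ /at_primeP[a [s [sp ->]]] /at_primeP[b [t [tp ->]]].
  apply/at_primeP; exists (a * b), (s * t); split; first exact: notin_primeM.
  by rewrite mulf_div !tofracM.
Qed.

HB.instance Definition _ :=
  GRing.isSubringClosed.Build {fraction R} at_prime_pred at_prime_subring.

(* The localization R_p, as a subring of the field of fractions of R. *)
Record at_prime := AtPrime { at_prime_val :> {fraction R};
                             _ : at_prime_val \in at_prime_pred }.

HB.instance Definition _ := [isSub for at_prime_val].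
HB.instance Definition _ := [Choice of at_prime by <:].
HB.instance Definition _ := [SubChoice_isSubComNzRing of at_prime by <:].

Record denominator := Denominator { denom_val :> R; _ : denom_val \notin p }.

HB.instance Definition _ := [isSub for denom_val].
HB.instance Definition _ := [Choice of denominator by <:].

Lemma denomP (s : denominator) : (s : R) \notin p.
Proof. exact: (valP s). Qed.

Implicit Types (x y : at_prime) (s t : denominator).

Definition denom1 : denominator := Denominator notin_prime1.

Definition denomM s t : denominator :=
  Denominator (notin_primeM (denomP s) (denomP t)).

Lemma tofrac_denom_neq0 s : tofrac (s : R) != 0 :> {fraction R}.
Proof. by rewrite tofrac_eq0 notin_prime_neq0 ?denomP. Qed.

Lemma at_prime_fraction x :
  exists q : R * denominator, val x == tofrac q.1 / tofrac (q.2 : R).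
Proof.
have /at_primeP[a [s [sp e]]] := valP x.
by exists (a, Denominator sp); apply/eqP.
Qed.

Definition at_prime_num x : R := (xchoose (at_prime_fraction x)).1.
Definition at_prime_den x : denominator := (xchoose (at_prime_fraction x)).2.

Lemma at_prime_numden x :
  val x = tofrac (at_prime_num x) / tofrac (at_prime_den x : R).
Proof. exact/eqP/(xchooseP (at_prime_fraction x)). Qed.

End LocalizationOfDomain.

(* The localization M_p: fractions m / s with s outside p, where m / s = n / t
   iff u (t m - s n) = 0 for some u outside p; (a / s) (m / t) = (a m) / (s t). *)
Section LocalizationOfModule.
Variables (R : idomainType) (p : prime_idealr R) (M : lmodType R).

Local Notation den v := (denom_val v.2).
Local Notation dom := (M * denominator p)%type.
Implicit Types (x y : at_prime p) (v w : dom).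

Definition eqfrac v w : bool :=
  `[< exists2 u : R, u \notin p &
        u *: (den w *: v.1) = u *: (den v *: w.1) >].

Lemma eqfrac_refl : reflexive eqfrac.
Proof. by move=> v; apply/asboolP; exists 1; rewrite ?notin_prime1. Qed.

Lemma eqfrac_sym : ssrbool.symmetric eqfrac.
Proof. by move=> v w; apply/asboolP/asboolP => -[u up e]; exists u. Qed.

Lemma eqfrac_trans : transitive eqfrac.
Proof.
move=> [n t] [m s] [k r] /asboolP[u up /= e1] /asboolP[v vp /= e2].
apply/asboolP; exists (u * v * denom_val t).
  by rewrite !notin_primeM ?denomP.
move: e1 e2; rewrite !scalerA /= => e1 e2.
transitivity ((v * denom_val r) *: ((u * denom_val t) *: m)).
  by rewrite !scalerA; congr (_ *: _); ring.
rewrite e1; transitivity ((u * denom_val s) *: ((v * denom_val r) *: n)).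
  by rewrite !scalerA; congr (_ *: _); ring.
by rewrite e2 !scalerA; congr (_ *: _); ring.
Qed.

Canonical eqfrac_equiv :=
  EquivRel eqfrac eqfrac_refl eqfrac_sym eqfrac_trans.

Definition locmod := {eq_quot eqfrac}.

HB.instance Definition _ : EqQuotient _ eqfrac locmod := EqQuotient.on locmod.
HB.instance Definition _ := Choice.on locmod.

Lemma eqfracP v w :
  reflect (exists2 u : R, u \notin p &
             u *: (den w *: v.1) = u *: (den v *: w.1))
          (v == w %[mod locmod]).
Proof. by rewrite eqmodE; exact: asboolP. Qed.

Lemma eqfrac_repr v :
  exists2 u : R, u \notin p &
    u *: (den v *: (repr (\pi_locmod v)).1)
    = u *: (den (repr (\pi_locmod v)) *: v.1).
Proof. by apply/eqfracP; rewrite reprK. Qed.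

Definition addfrac v w : dom :=
  (den w *: v.1 + den v *: w.1, denomM v.2 w.2).
Definition oppfrac v : dom := (- v.1, v.2).
Definition scalefrac x v : dom :=
  (at_prime_num x *: v.1, denomM (at_prime_den x) v.2).

Definition locmod_zero : locmod := \pi_locmod (0, denom1 p).
Definition locmod_opp (a : locmod) : locmod := \pi_locmod (oppfrac (repr a)).
Definition locmod_add (a b : locmod) : locmod :=
  \pi_locmod (addfrac (repr a) (repr b)).
Definition locmod_scale x (a : locmod) : locmod := \pi_locmod (scalefrac x (repr a)).

Lemma pi_oppfrac v : \pi_locmod (oppfrac v) = locmod_opp (\pi_locmod v).
Proof.
apply/eqP/eqfracP; have [u up e] := eqfrac_repr v; exists u => //=.
by rewrite !scalerN e.
Qed.

Lemma pi_addfrac v w : \pi_locmod (addfrac v w) = locmod_add (\pi_locmod v) (\pi_locmod w).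
Proof.
apply/eqP/eqfracP; case: (eqfrac_repr v) (eqfrac_repr w).
set v' := repr _; set w' := repr _ => u up e1 [u' up' e2].
exists (u * u'); first exact: notin_primeM.
rewrite /= !scalerDr !scalerA in e1 e2 *; congr (_ + _).
  transitivity ((u' * den w' * den w) *: ((u * den v') *: v.1)).
    by rewrite !scalerA; congr (_ *: _); ring.
  by rewrite -e1 !scalerA; congr (_ *: _); ring.
transitivity ((u * den v' * den v) *: ((u' * den w') *: w.1)).
  by rewrite !scalerA; congr (_ *: _); ring.
by rewrite -e2 !scalerA; congr (_ *: _); ring.
Qed.

Lemma locmod_scale_pi x v (a : R) (s : denominator p) :
    val x = tofrac a / tofrac (s : R) ->
  locmod_scale x (\pi_locmod v) = \pi_locmod (a *: v.1, denomM s v.2).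
Proof.
rewrite at_prime_numden => /eqP; rewrite eqr_div ?tofrac_denom_neq0 //.
rewrite -!tofracM tofrac_eq => /eqP ex.
apply/eqP/eqfracP; have [u up e] := eqfrac_repr v; exists u => //=.
move: e; set v' := repr _ => e; rewrite !scalerA in e *.
transitivity ((at_prime_num x * denom_val s) *: ((u * den v) *: v'.1)).
  by rewrite !scalerA; congr (_ *: _); ring.
by rewrite e ex !scalerA; congr (_ *: _); ring.
Qed.

Lemma locmod_addA : associative locmod_add.
Proof.
elim/quotW=> u; elim/quotW=> v; elim/quotW=> w.
rewrite -(pi_addfrac u v) -(pi_addfrac v w) -!pi_addfrac.
apply/eqP/eqfracP; exists 1; rewrite ?notin_prime1 //=.
by rewrite !scalerDr !scalerA addrA; congr (_ *: _ + _ *: _ + _ *: _); ring.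
Qed.

Lemma locmod_addC : commutative locmod_add.
Proof.
elim/quotW=> v; elim/quotW=> w; rewrite -!pi_addfrac.
apply/eqP/eqfracP; exists 1; rewrite ?notin_prime1 //=.
by rewrite addrC [den v * _]mulrC.
Qed.

Lemma locmod_add0 : left_id locmod_zero locmod_add.
Proof.
elim/quotW=> v; rewrite -!pi_addfrac.
apply/eqP/eqfracP; exists 1; rewrite ?notin_prime1 //=.
by rewrite scaler0 add0r !scale1r mul1r.
Qed.

Lemma locmod_addN : left_inverse locmod_zero locmod_opp locmod_add.
Proof.
elim/quotW=> v; rewrite -pi_oppfrac -pi_addfrac.
apply/eqP/eqfracP; exists 1; rewrite ?notin_prime1 //=.
by rewrite scalerN addNr !scaler0.
Qed.

HB.instance Definition _ :=
  GRing.isZmodule.Build locmod locmod_addA locmod_addC locmod_add0 locmod_addN.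

Lemma locmod_scaleA x y (a : locmod) :
  locmod_scale x (locmod_scale y a) = locmod_scale (x * y) a.
Proof.
elim/quotW: a => v.
rewrite (locmod_scale_pi _ (at_prime_numden y)).
rewrite (locmod_scale_pi _ (at_prime_numden x)).
rewrite (@locmod_scale_pi _ _ (at_prime_num x * at_prime_num y)
           (denomM (at_prime_den x) (at_prime_den y))); last first.
  by rewrite rmorphM /= !at_prime_numden mulf_div !tofracM.
apply/eqP/eqfracP; exists 1; rewrite ?notin_prime1 //=.
by rewrite !scalerA; congr (_ *: _); ring.
Qed.

Lemma locmod_scale1 : left_id 1 locmod_scale.
Proof.
elim/quotW=> v; rewrite (@locmod_scale_pi _ _ 1 (denom1 p)); last first.
  by rewrite rmorph1 /= tofrac1 divr1.
apply/eqP/eqfracP; exists 1; rewrite ?notin_prime1 //=.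
by rewrite !scale1r mul1r.
Qed.

Lemma locmod_scaleDr : right_distributive locmod_scale locmod_add.
Proof.
move=> x; elim/quotW=> v; elim/quotW=> w; rewrite -pi_addfrac.
rewrite !(locmod_scale_pi _ (at_prime_numden x)) -pi_addfrac.
apply/eqP/eqfracP; exists 1; rewrite ?notin_prime1 //=.
by rewrite !scalerDr !scalerA; congr (_ *: _ + _ *: _); ring.
Qed.

Lemma locmod_scaleDl (a : locmod) :
  {morph locmod_scale^~ a : x y / x + y >-> locmod_add x y}.
Proof.
elim/quotW: a => v x y.
rewrite (locmod_scale_pi _ (at_prime_numden x)).
rewrite (locmod_scale_pi _ (at_prime_numden y)) -pi_addfrac.
rewrite (@locmod_scale_pi _ _
  (at_prime_num x * denom_val (at_prime_den y)
     + at_prime_num y * denom_val (at_prime_den x))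
  (denomM (at_prime_den x) (at_prime_den y))); last first.
  rewrite rmorphD /= !at_prime_numden addf_div ?tofrac_denom_neq0 //.
  by rewrite tofracD !tofracM.
apply/eqP/eqfracP; exists 1; rewrite ?notin_prime1 //=.
by rewrite !scalerDr !scalerA -!scalerDl; congr (_ *: _); ring.
Qed.

HB.instance Definition _ := GRing.Zmodule_isLmodule.Build (at_prime p) locmod
  locmod_scaleA locmod_scale1 locmod_scaleDr locmod_scaleDl.

End LocalizationOfModule.

Section Modules.
Variables (R : idomainType) (M : lmodType R).

(* M_p is isomorphic to R_p as an R_p-module, for every p in Spec R. *)
Definition locally_free_rank1 : Prop :=
  forall p : prime_idealr R,
    exists f : {linear locmod p M -> (at_prime p)^o}, bijective f.

Definition generated_by_two : Prop :=
  exists g h : M, forall m : M, exists a b : R, m = a *: g + b *: h.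

Definition is_basis (B : {pred M}) : Prop :=
  (forall (s : seq M) (c : M -> R), uniq s -> {subset s <= B} ->
     \sum_(x <- s) c x *: x = 0 -> forall x, x \in s -> c x = 0) /\
  (forall m : M, exists (s : seq M) (c : M -> R),
     {subset s <= B} /\ m = \sum_(x <- s) c x *: x).

Definition free_module : Prop := exists B : {pred M}, is_basis B.

End Modules.

(* Main.v *)
Require Import Defs.
From HB Require Import structures.
From mathcomp Require Import all_boot all_algebra.
From mathcomp Require Import generic_quotient ring_quotient.
From mathcomp Require Import boolp mpoly.
From mathcomp Require Import ring zify.
From mathcomp Require classical_sets.

(* Over a domain A, a tame automorphism that is not affine is (H1 + p(H2), H2)
   followed by an affine automorphism, with (H1, H2) tame, deg H1 <= deg H2 and
   deg p >= 2.  Hence, if its components F1, F2 have equal degrees, their leading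
   forms are in a ratio x : y with (x, y) unimodular over A, and if
   deg F2 < deg F1, then deg (F1 - c F2^k) < deg F1 for some c in A.

   (2 => 1) Let F be tame over every R_p.  In the second case c is unique, so it
   lies in the intersection R of the R_p.  In the first case the ideal (a, b) of R
   generated by two corresponding coefficients of F1, F2 is locally principal, so
   by (2) it is principal and the ratio is unimodular over R.  Either way a tame
   automorphism over R lowers deg F1 + deg F2.

   (1 => 2) A locally free module of rank 1 generated by g, h has the relations of
   an ideal (a, b) of R.  With L = b X - a Y, the automorphism
   (X + a L^2, Y + b L^2) is tame over every R_p, hence over R, so a : b is
   unimodular over R, and (a, b) is principal. *)

Set Implicit Arguments.
Unset Strict Implicit.
Unset Printing Implicit Defensive.

Import GRing.Theory.

Local Open Scope ring_scope.

(** * Substitution in two variables *)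

Section Substitution.
Variable A : comNzRingType.
Implicit Types (F G H : 2.-tuple {mpoly A[2]}) (P Q E : {mpoly A[2]}).

Local Notation X := ('X_ord0 : {mpoly A[2]}).
Local Notation Y := ('X_ord_max : {mpoly A[2]}).

Lemma tnth_pair0 (T : Type) (x y : T) : tnth [tuple x; y] ord0 = x.
Proof. by []. Qed.

Lemma tnth_pair1 (T : Type) (x y : T) : tnth [tuple x; y] ord_max = y.
Proof. by []. Qed.

Lemma pair_eta (T : Type) (t : 2.-tuple T) :
  t = [tuple tnth t ord0; tnth t ord_max].
Proof.
apply: eq_from_tnth => i.
by case: (unliftP ord_max i) => [j|] ->; rewrite ?(ord1 j) //;
   congr tnth; apply: val_inj.
Qed.

Lemma endo_X0 F : endo F X = tnth F ord0.
Proof. by rewrite /endo comp_mpolyXU -tnth_nth. Qed.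

Lemma endo_X1 F : endo F Y = tnth F ord_max.
Proof. by rewrite /endo comp_mpolyXU -tnth_nth. Qed.

Lemma endo_idX : endo_id A = [tuple X; Y].
Proof. by rewrite [LHS]pair_eta !tnth_mktuple. Qed.

Lemma endo_comp_pair F P Q :
  endo_comp F [tuple P; Q] = [tuple endo F P; endo F Q].
Proof. by rewrite [LHS]pair_eta !tnth_mktuple. Qed.

Lemma endo_compA F G H :
  endo_comp F (endo_comp G H) = endo_comp (endo_comp F G) H.
Proof. by apply: eq_from_tnth => i; rewrite !tnth_mktuple endo_compE. Qed.

Lemma endo_compF1 F : endo_comp F (endo_id A) = F.
Proof. by rewrite endo_idX endo_comp_pair endo_X0 endo_X1 -pair_eta. Qed.

Lemma endo_comp1F F : endo_comp (endo_id A) F = F.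
Proof. by apply: eq_from_tnth => i; rewrite !tnth_mktuple endo_idE. Qed.

Definition inverse F G := endo_comp F G = endo_id A /\ endo_comp G F = endo_id A.

Lemma inverse_GA2 F G : inverse F G -> GA2 F.
Proof.
move=> [FG GF]; exists (endo G) => P.
- by rewrite -[LHS]/((endo G \o endo F) P) -endo_compE GF endo_idE.
- by rewrite -[LHS]/((endo F \o endo G) P) -endo_compE FG endo_idE.
Qed.

(** The inverse map [g] is not known to be an algebra morphism. The pair ([g X], [g Y]) is a right
    inverse by its values on the variables, and injectivity of [endo F] makes it a left inverse. *)
Lemma GA2_inverse F : GA2 F -> exists G, inverse F G.
Proof.
case=> g Kg gK; exists [tuple g X; g Y].
have FG : endo_comp F [tuple g X; g Y] = endo_id A.
  by rewrite endo_comp_pair !gK endo_idX.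
split=> //; apply: eq_from_tnth => i; rewrite !tnth_mktuple.
apply: (can_inj Kg); rewrite -[LHS]/((endo F \o endo _) _) -endo_compE FG.
by rewrite endo_idE /endo comp_mpolyXU -tnth_nth.
Qed.

Lemma inverse_comp F F' G G' :
  inverse F F' -> inverse G G' -> inverse (endo_comp F G) (endo_comp G' F').
Proof.
move=> [FF' F'F] [GG' G'G]; split.
- by rewrite -endo_compA [endo_comp G _]endo_compA GG' endo_comp1F.
- by rewrite -endo_compA [endo_comp F' _]endo_compA F'F endo_comp1F.
Qed.

Lemma TA2_inverse F : TA2 F -> exists G, inverse F G.
Proof.
elim=> {F} [F FGA _|F FGA _||F G _ [F' FF'] _ [G' GG']|F G _ [F' FF'] FG GF].
- exact: GA2_inverse.
- exact: GA2_inverse.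
- by exists (endo_id A); split; rewrite endo_comp1F.
- by exists (endo_comp G' F'); apply: inverse_comp.
- by exists F.
Qed.

Definition pev (p : {poly A}) E : {mpoly A[2]} :=
  (map_poly (@mpolyC 2 A) p).[E].

Lemma pevD p q E : pev (p + q) E = pev p E + pev q E.
Proof. by rewrite /pev rmorphD hornerD. Qed.

Lemma pevZ c p E : pev (c *: p) E = c *: pev p E.
Proof. by rewrite /pev map_polyZ hornerZ mul_mpolyC. Qed.

Lemma pevMX p E : pev (p * 'X) E = pev p E * E.
Proof. by rewrite /pev rmorphM /= map_polyX hornerMX. Qed.

Lemma pevC c E : pev c%:P E = c%:MP.
Proof. by rewrite /pev map_polyC hornerC. Qed.

Lemma pevX E : pev 'X E = E.
Proof. by rewrite /pev map_polyX hornerX. Qed.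

Lemma pevM p q E : pev (p * q) E = pev p E * pev q E.
Proof. by rewrite /pev rmorphM hornerM. Qed.

Lemma pevXn p k E : pev (p ^+ k) E = pev p E ^+ k.
Proof. by rewrite /pev rmorphXn horner_exp. Qed.

Lemma pev0 E : pev 0 E = 0.
Proof. by rewrite pevC mpolyC0. Qed.

Lemma pevN p E : pev (- p) E = - pev p E.
Proof. by rewrite /pev rmorphN hornerN. Qed.

Lemma pev_comp p q E : pev (p \Po q) E = pev p (pev q E).
Proof.
elim/poly_ind: p => [|p c IH]; first by rewrite comp_poly0 !pev0.
by rewrite comp_polyD comp_polyM comp_polyX comp_polyC !pevD pevMX pevM IH !pevC.
Qed.

Lemma endoD F : {morph endo F : P Q / P + Q}.
Proof. exact: comp_mpolyD. Qed.

Lemma endo_pev F p E : endo F (pev p E) = pev p (endo F E).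
Proof.
elim/poly_ind: p => [|p c IH]; first by rewrite !pev0 /endo comp_mpoly0.
by rewrite !pevD !pevMX !pevC -IH /endo comp_mpolyD rmorphM /= comp_mpolyC.
Qed.

Lemma pev_size2 (p : {poly A}) E :
  (size p <= 2)%N -> pev p E = p`_1 *: E + (p`_0)%:MP.
Proof.
move=> sp; rewrite {1}(_ : p = p`_1 *: 'X + (p`_0)%:P).
  by rewrite pevD pevZ pevX pevC.
apply/polyP=> -[|[|i]]; rewrite coefD coefZ coefX coefC ?mulr0 ?add0r ?mulr1 ?addr0 //.
by rewrite nth_default // (leq_trans sp).
Qed.

Definition lin a b c P Q : {mpoly A[2]} := a *: P + b *: Q + c%:MP.

Lemma endo_lin F a b c P Q : endo F (lin a b c P Q) = lin a b c (endo F P) (endo F Q).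
Proof. by rewrite /endo /lin !comp_mpolyD !comp_mpolyZ comp_mpolyC. Qed.

Definition linmap a b c a' b' c' : 2.-tuple {mpoly A[2]} :=
  [tuple lin a b c X Y; lin a' b' c' X Y].

(** Composition on the right operates on the components of [F], which is why tame automorphisms are
    built up below by right factors. *)
Lemma comp_linmap F a b c a' b' c' :
  endo_comp F (linmap a b c a' b' c')
  = [tuple lin a b c (tnth F ord0) (tnth F ord_max);
           lin a' b' c' (tnth F ord0) (tnth F ord_max)].
Proof. by rewrite endo_comp_pair !endo_lin endo_X0 endo_X1. Qed.

Definition elem p : 2.-tuple {mpoly A[2]} := [tuple X + pev p Y; Y].

Lemma comp_elem F p :
  endo_comp F (elem p)
  = [tuple tnth F ord0 + pev p (tnth F ord_max); tnth F ord_max].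
Proof.
by rewrite endo_comp_pair endoD endo_pev endo_X0 endo_X1.
Qed.

End Substitution.

(** * Degrees of tame automorphisms *)

Section Degree.
Variable A : idomainType.
Implicit Types (F G H : 2.-tuple {mpoly A[2]}) (P Q E D : {mpoly A[2]}).

Local Notation X := ('X_ord0 : {mpoly A[2]}).
Local Notation Y := ('X_ord_max : {mpoly A[2]}).

Lemma msizeD_lt P Q n : (msize P < n)%N -> (msize Q < n)%N -> (msize (P + Q) < n)%N.
Proof.
by move=> lP lQ; apply: leq_ltn_trans (msizeD_le _ _) _; rewrite gtn_max lP.
Qed.

Lemma msizeDl P Q : (msize Q < msize P)%N -> msize (P + Q) = msize P.
Proof.
move=> lt; apply/eqP; rewrite eqn_leq; apply/andP; split.
  by rewrite (leq_trans (msizeD_le _ _)) // geq_max leqnn ltnW.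
rewrite leqNgt; apply/negP => lt2.
have := msizeD_lt lt2 (_ : (msize (- Q) < msize P)%N).
by rewrite msizeN addrK ltnn => /(_ lt).
Qed.

Lemma msizeC_lt c P : (1 < msize P)%N -> (msize (c%:MP : {mpoly A[2]}) < msize P)%N.
Proof. by rewrite msizeC; case: (c != 0) => // /ltnW. Qed.

Lemma msize_linl a b c P Q : a != 0 -> (1 < msize P)%N -> (msize Q < msize P)%N ->
  msize (lin a b c P Q) = msize P.
Proof.
move=> a0 lP lQ; have e : msize (a *: P) = msize P by rewrite msizeZ.
rewrite /lin -addrA msizeDl ?e //; apply: msizeD_lt; last exact: msizeC_lt.
exact: leq_ltn_trans (msizeZ_le _ _) lQ.
Qed.

Lemma msize_linr b c P Q : b != 0 -> (1 < msize Q)%N ->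
  msize (lin 0 b c P Q) = msize Q.
Proof.
move=> b0 lQ; have e : msize (b *: Q) = msize Q by rewrite msizeZ.
by rewrite /lin scale0r add0r msizeDl ?e // msizeC_lt.
Qed.

(** Horner induction: degrees add in the product with the nonconstant [E], and the constant added
    next cannot cancel its top part. The predecessors turn [size] and [msize] into degrees. *)
Lemma msize_pev (p : {poly A}) E : (1 < msize E)%N -> p != 0 ->
  msize (pev p E) = ((size p).-1 * (msize E).-1).+1.
Proof.
move=> lE; have E0 : E != 0 by rewrite -msize_poly_eq0; case: (msize E) lE.
elim/poly_ind: p => [|p c IH]; first by rewrite eqxx.
rewrite pevD pevMX pevC size_MXaddC; have [-> /=|p0 _] := eqVneq p 0.
  rewrite pev0 !mul0r !add0r polyC_eq0 msizeC size_poly0.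
  by case: (c == 0).
have q0 : pev p E != 0 by rewrite -msize_poly_eq0 IH.
have e : msize (pev p E * E) = (size p * (msize E).-1).+1.
  rewrite msizeM // IH //; have : (0 < size p)%N by rewrite size_poly_gt0.
  by case: (size p) => // n _; case: (msize E) lE => // m _; rewrite /= mulSn; lia.
rewrite /= msizeDl ?e // msizeC; case: (c != 0) => //.
by rewrite ltnS muln_gt0 size_poly_gt0 p0 /=; case: (msize E) lE => [|[|]].
Qed.

Lemma msize_pev_lt (p : {poly A}) E n : (1 < msize E)%N -> (size p < n)%N -> (1 < n)%N ->
  (msize (pev p E) < (n.-1 * (msize E).-1).+1)%N.
Proof.
move=> lE lp n1; have [->|p0] := eqVneq p 0; first by rewrite pev0 msize0.
rewrite msize_pev // ltnS ltn_pmul2r; first by case: (size p) lp; case: n n1; lia.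
by case: (msize E) lE => [|[|]].
Qed.

Lemma msize_gt1 P i : P@_U_(i) != 0 -> (1 < msize P)%N.
Proof. by rewrite -mcoeff_msupp => /msize_mdeg_lt; rewrite mdeg1. Qed.

Lemma lin_X0 a b c : (lin a b c X Y)@_U_(ord0) = a.
Proof.
rewrite /lin !mcoeffD !mcoeffZ !mcoeffXU mcoeffC mnm1_eq0 /=.
by rewrite mulr1 !mulr0 !addr0.
Qed.

Lemma lin_X1 a b c : (lin a b c X Y)@_U_(ord_max) = b.
Proof.
rewrite /lin !mcoeffD !mcoeffZ !mcoeffXU mcoeffC mnm1_eq0 /=.
by rewrite mulr1 !mulr0 !addr0 add0r.
Qed.

Lemma msize_linXY a b c : (msize (lin a b c X Y) <= 2)%N.
Proof.
have Z (d : A) i : (msize (d *: ('X_i : {mpoly A[2]})) < 3)%N.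
  by rewrite (leq_ltn_trans (msizeZ_le _ _)) // msizeX mdeg1.
rewrite -ltnS /lin !msizeD_lt // msizeC; by case: (c != 0).
Qed.

Lemma det_unit_row1 (a b a' b' : A) : a * b' - b * a' \is a GRing.unit ->
  (a != 0) || (b != 0).
Proof.
by apply: contraTT; rewrite negb_or !negbK => /andP[/eqP-> /eqP->];
   rewrite !mul0r subr0 unitr0.
Qed.

Lemma det_unit_row2 (a b a' b' : A) : a * b' - b * a' \is a GRing.unit ->
  (a' != 0) || (b' != 0).
Proof.
by apply: contraTT; rewrite negb_or !negbK => /andP[/eqP-> /eqP->];
   rewrite !mulr0 subr0 unitr0.
Qed.

Lemma msize_linXY_eq2 a b c : (a != 0) || (b != 0) -> msize (lin a b c X Y) = 2%N.
Proof.
move=> ab; apply/eqP; rewrite eqn_leq msize_linXY; case/orP: ab => ab.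
  by apply: (@msize_gt1 _ ord0); rewrite lin_X0.
by apply: (@msize_gt1 _ ord_max); rewrite lin_X1.
Qed.

(* Pairs that are affine, or obtained from a pair (P, Q) of the same kind with
   deg P <= deg Q by an elementary automorphism of degree at least 2 followed by an
   affine one: the degrees in such a composition are under control. *)
Inductive reduced : {mpoly A[2]} -> {mpoly A[2]} -> Prop :=
| reduced_affine (a b c a' b' c' : A) : a * b' - b * a' \is a GRing.unit ->
    reduced (lin a b c X Y) (lin a' b' c' X Y)
| reduced_elem P Q (p : {poly A}) (a b c a' b' c' : A) :
    reduced P Q -> (msize P <= msize Q)%N -> (2 < size p)%N ->
    a * b' - b * a' \is a GRing.unit ->
    reduced (lin a b c (P + pev p Q) Q) (lin a' b' c' (P + pev p Q) Q).

(** As deg [p] >= 2 and deg [Q] >= 1, the degree of [pev p Q] exceeds that of [Q], hence that of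
    [P]. *)
Lemma msizeD_pev P Q (p : {poly A}) : (1 < msize Q)%N -> (msize P <= msize Q)%N ->
  (2 < size p)%N ->
  msize (P + pev p Q) = ((size p).-1 * (msize Q).-1).+1
  /\ (msize Q < msize (P + pev p Q))%N.
Proof.
move=> lQ PQ lp; have p0 : p != 0 by rewrite -size_poly_gt0; lia.
have := msize_pev lQ p0; set n := (_ * _)%N => e.
have lt : (msize Q < n.+1)%N by rewrite /n; nia.
by rewrite addrC msizeDl e //; apply: leq_ltn_trans lt.
Qed.

Lemma reduced_msize P Q : reduced P Q -> (1 < msize P)%N /\ (1 < msize Q)%N.
Proof.
elim=> {P Q} [a b c a' b' c' u|P Q p a b c a' b' c' _ [lP lQ] PQ lp u].
  by rewrite !msize_linXY_eq2 ?(det_unit_row1 u) ?(det_unit_row2 u).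
have [_ lt] := msizeD_pev lQ PQ lp.
have key d e f : (d != 0) || (e != 0) -> (1 < msize (lin d e f (P + pev p Q) Q))%N.
  have [->|d0 _] := eqVneq d 0; first by move=> /= e0; rewrite msize_linr.
  by rewrite msize_linl //; apply: ltn_trans lt.
by split; apply: key; [apply: det_unit_row1 u|apply: det_unit_row2 u].
Qed.

Lemma lin_lin a b c a1 b1 c1 a2 b2 c2 P Q :
  lin a b c (lin a1 b1 c1 P Q) (lin a2 b2 c2 P Q)
  = lin (a * a1 + b * a2) (a * b1 + b * b2) (a * c1 + b * c2 + c) P Q.
Proof.
by rewrite /lin -!mul_mpolyC !mpolyCD !mpolyCM; ring.
Qed.

Lemma reduced_lin P Q (a b c a' b' c' : A) : reduced P Q ->
  a * b' - b * a' \is a GRing.unit ->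
  reduced (lin a b c P Q) (lin a' b' c' P Q).
Proof.
case=> {P Q} [a1 b1 c1 a2 b2 c2 u v|P Q p a1 b1 c1 a2 b2 c2 PQ l lp u v].
  rewrite !lin_lin; apply: reduced_affine.
  rewrite [X in X \is a _](_ : _ = (a * b' - b * a') * (a1 * b2 - b1 * a2)); last by ring.
  by rewrite unitrM v.
rewrite !lin_lin; apply: reduced_elem => //.
rewrite [X in X \is a _](_ : _ = (a * b' - b * a') * (a1 * b2 - b1 * a2)); last by ring.
by rewrite unitrM v.
Qed.

Lemma lin10 P Q : lin 1 0 0 P Q = P.
Proof. by rewrite /lin scale1r scale0r mpolyC0 !addr0. Qed.

Lemma lin01 P Q : lin 0 1 0 P Q = Q.
Proof. by rewrite /lin scale1r scale0r mpolyC0 add0r addr0. Qed.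

(** For deg [p] >= 2, either the pair is ready for one more elementary layer, or its second
    component is affine in the inner [Q] and the new factor merges with the previous elementary
    one. *)
Lemma reduced_comp_elem P Q p : reduced P Q -> reduced (P + pev p Q) Q.
Proof.
have det1 : (1 : A) * 1 - 0 * 0 \is a GRing.unit by rewrite mul0r subr0 mulr1 unitr1.
move=> PQ; case: (leqP (size p) 2) => lp.
  rewrite pev_size2 //.
  have -> : P + (p`_1 *: Q + (p`_0)%:MP) = lin 1 p`_1 p`_0 P Q.
    by rewrite /lin scale1r addrA.
  rewrite -{2}[Q](lin01 P); apply: reduced_lin => //.
  by rewrite mulr0 subr0 mulr1 unitr1.
have std P' Q' : reduced P' Q' -> (msize P' <= msize Q')%N ->
    reduced (P' + pev p Q') Q'.
  move=> r l; rewrite -[X in reduced X _](lin10 _ Q') -[X in reduced _ X](lin01 (P' + pev p Q')).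
  exact: reduced_elem.
case: PQ => {P Q} [a b c a' b' c' u|P Q q a b c a' b' c' PQ l lq u].
  apply: std; first exact: reduced_affine.
  by rewrite !msize_linXY_eq2 ?(det_unit_row1 u) ?(det_unit_row2 u).
have [_ lQ] := reduced_msize PQ.
have [_ lt] := msizeD_pev lQ l lq.
(* If [a'] is nonzero, the second component has the degree of [P + pev q Q], which bounds that of
   the first, so [std] applies. *)
have [a'0|a'0] := eqVneq a' 0; last first.
  apply: std; first exact: reduced_elem.
  have lD := ltn_trans lQ lt.
  rewrite [X in (_ <= X)%N]msize_linl //.
  have [a0|a0] := eqVneq a 0; last by rewrite msize_linl.
  by rewrite a0 msize_linr ?(ltnW lt) //; have := det_unit_row1 u; rewrite a0 eqxx.
move: u; rewrite a'0 mulr0 subr0 unitrM => /andP[ua ub'].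
(* Chosen so that a (P + q'(Q)) = a (P + q(Q)) + p(b' Q + c'). *)
pose q' := q + a^-1 *: (p \Po (b' *: 'X + c'%:P)).
have e : lin a b c (P + pev q Q) Q + pev p (lin 0 b' c' (P + pev q Q) Q)
    = lin a b c (P + pev q' Q) Q.
  rewrite /q' pevD pevZ pev_comp pevD pevZ pevX pevC /lin scale0r add0r.
  rewrite !scalerDr scalerA mulrV // scale1r -!addrA; do 2!congr (_ + _).
  by rewrite addrA addrC.
rewrite e; case: (ltnP 2 (size q')) => lq'.
  have -> : lin 0 b' c' (P + pev q Q) Q = lin 0 b' c' (P + pev q' Q) Q.
    by rewrite /lin !scale0r.
  by apply: reduced_elem => //; rewrite mulr0 subr0 unitrM ua.
(* The high terms of the two elementary factors have cancelled: [q'] has degree at most 1, and an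
   affine image of ([P], [Q]) remains. *)
rewrite pev_size2 //.
have -> : lin a b c (P + (q'`_1 *: Q + (q'`_0)%:MP)) Q
    = lin a (a * q'`_1 + b) (a * q'`_0 + c) P Q.
  rewrite /lin !scalerDr !scalerDl !scalerA mpolyCD mpolyCM mul_mpolyC -!addrA.
  by do 2!congr (_ + _); rewrite addrCA.
have -> : lin 0 b' c' (P + pev q Q) Q = lin 0 b' c' P Q.
  by rewrite /lin !scale0r.
by apply: reduced_lin => //; rewrite mulr0 subr0 unitrM ua.
Qed.

End Degree.

(** * Leading forms of the components of a reduced pair *)

Section LeadingForms.
Variable A : idomainType.
Implicit Types (P Q E D : {mpoly A[2]}).

Local Notation X := ('X_ord0 : {mpoly A[2]}).
Local Notation Y := ('X_ord_max : {mpoly A[2]}).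

(** The dominant polynomial [D] enters the components with coefficients [a] and [a'], a column of an
    invertible matrix. Eliminating it leaves a multiple of the inner [Q] plus a constant. *)
Lemma reduced_eq_msize P Q : reduced P Q -> (2 < msize P)%N -> msize P = msize Q ->
  exists x y u v : A, u * x + v * y = 1 /\ (msize (y *: P - x *: Q)%R < msize P)%N.
Proof.
case=> {P Q} [a b c a' b' c' u|P Q p a b c a' b' c' PQ l lp u].
  by rewrite ltnNge msize_linXY.
have [_ lQ] := reduced_msize PQ; have [_ lt] := msizeD_pev lQ l lp.
move: lt; set D := P + _ => lt _ e; have lD := ltn_trans lQ lt.
pose d := a * b' - b * a'; exists a, a', (b' * d^-1), (- b * d^-1); split.
  by rewrite -[RHS](mulrV u) -/d; move: d^-1 => d'; rewrite /d; ring.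
have -> : a' *: lin a b c D Q - a *: lin a' b' c' D Q = lin 0 (- d) (a' * c - a * c') D Q.
  by rewrite /lin /d -!mul_mpolyC !(mpolyCB, mpolyCN, mpolyCM, mpolyC0); ring.
(* If [a] is 0, then [a'] is nonzero, and the equality of degrees still yields the degree of [D]. *)
have -> : msize (lin a b c D Q) = msize D.
  have [a0|a0] := eqVneq a 0; last by rewrite msize_linl.
  by rewrite e msize_linl //; apply: contraTneq u => ->; rewrite a0 mul0r mulr0 subr0 unitr0.
by rewrite msize_linr // oppr_eq0; 
   apply: contraTneq u => /eqP; rewrite /d => /eqP->; rewrite unitr0.
Qed.

Lemma size_sub_lead (p q : {poly A}) : size p = size q -> lead_coef p = lead_coef q ->
  (0 < size p)%N -> (size (p - q)%R < size p)%N.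
Proof.
move=> e el sp; rewrite -(prednK sp) ltnS; apply/leq_sizeP => j.
rewrite leq_eqVlt => /predU1P[<-|lt]; rewrite coefB.
  by apply/eqP; rewrite subr_eq0 {2}e -!lead_coefE el.
have sj : (size p <= j)%N by rewrite -(prednK sp).
by rewrite !nth_default ?subr0 // -e.
Qed.

(** A second component of smaller degree does not involve the dominant polynomial: it is affine in
    the inner [Q], and a multiple of its power cancels the top term of [p]. The exponent is given by
    degrees alone, so it will be the same at every prime. *)
Lemma reduced_gt_msize P Q : reduced P Q -> (msize Q < msize P)%N ->
  exists c : A,
    (msize (P - c *: Q ^+ ((msize P).-1 %/ (msize Q).-1))%R < msize P)%N.
Proof.
case=> {P Q} [a b c a' b' c' u|P Q p a b c a' b' c' PQ l lp u].
  by rewrite !msize_linXY_eq2 ?(det_unit_row1 u) ?(det_unit_row2 u).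
have [_ lQ] := reduced_msize PQ; have [sD lt] := msizeD_pev lQ l lp.
have lD := ltn_trans lQ lt.
have [a'0|a'0] := eqVneq a' 0; last first.
  rewrite [X in (X < _)%N]msize_linl // ltnNge.
  have [a0|a0] := eqVneq a 0; last by rewrite msize_linl ?leqnn.
  by rewrite a0 msize_linr ?(ltnW lt) //; have := det_unit_row1 u; rewrite a0 eqxx.
move: u; rewrite a'0 mulr0 subr0 unitrM => /andP[ua ub'] _.
have a0 : a != 0 by apply: contraTneq ua => ->; rewrite unitr0.
have b'0 : b' != 0 by apply: contraTneq ub' => ->; rewrite unitr0.
rewrite msize_linr // msize_linl // sD /= mulnK; last by case: (msize Q) lQ => [|[|]].
set k := (size p).-1; pose q : {poly A} := b' *: 'X + c'%:P.
(* The second component is q(Q), and [e] is the ratio of the leading coefficients of [a *: p] and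
   [q ^+ k], both of degree [k]. *)
pose e := a * lead_coef p / b' ^+ k.
have lq : size (b' *: 'X : {poly A}) = 2%N by rewrite size_scale // size_polyX.
have sC : (size (c'%:P : {poly A}) < size (b' *: 'X : {poly A}))%N.
  by rewrite lq ltnS size_polyC_leq1.
have sq : size q = 2%N by rewrite size_polyDl.
have lcq : lead_coef q = b' by rewrite lead_coefDl // lead_coefZ lead_coefX mulr1.
have e0 : e != 0.
  by rewrite !mulf_neq0 ?lead_coef_eq0 -?size_poly_gt0 ?(ltnW (ltnW lp)) //
     invr_eq0 expf_neq0.
exists e; pose r := a *: p - e *: q ^+ k + (b *: 'X + c%:P).
have -> : lin a b c (P + pev p Q) Q - e *: lin 0 b' c' (P + pev p Q) Q ^+ k
    = a *: P + pev r Q.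
  rewrite /r !pevD pevN !pevZ pevXn /q pevD pevZ pevX !pevC /lin scale0r add0r.
  by rewrite -!mul_mpolyC; ring.
have sk : k.+1 = size p by rewrite /k prednK //; lia.
have sp : (size (a *: p - e *: q ^+ k)%R < size p)%N.
  rewrite -(size_scale p a0); apply: size_sub_lead.
  - have q0 : q != 0 by rewrite -size_poly_gt0 sq.
    by rewrite !size_scale // (polySpred (expf_neq0 k q0)) size_exp sq mul1n.
  - by rewrite !lead_coefZ lead_coef_exp lcq /e divrK // unitrX.
  - by rewrite size_scale //; lia.
have sr : (size r < size p)%N.
  apply: leq_ltn_trans (size_polyD _ _) _; rewrite gtn_max sp /=.
  apply: leq_ltn_trans (size_polyD _ _) _.
  rewrite gtn_max (leq_ltn_trans (size_scale_leq _ _)) ?size_polyX //=.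
  exact: leq_ltn_trans (size_polyC_leq1 _) (ltnW lp).
apply: msizeD_lt; last by apply: msize_pev_lt => //; lia.
rewrite -sD; apply: leq_ltn_trans (msizeZ_le _ _) (leq_ltn_trans l lt).
Qed.

End LeadingForms.

(** * Affine automorphisms have invertible matrices *)

Section Classification.
Variable A : idomainType.
Implicit Types (F G H : 2.-tuple {mpoly A[2]}) (P Q E D : {mpoly A[2]}).

Local Notation X := ('X_ord0 : {mpoly A[2]}).
Local Notation Y := ('X_ord_max : {mpoly A[2]}).

Lemma ord2P (i : 'I_2) : i = ord0 \/ i = ord_max.
Proof. by case: i => -[|[|]] // i; [left|right]; apply: val_inj. Qed.

Lemma msize_le2_lin P : (msize P <= 2)%N ->
  P = lin P@_U_(ord0) P@_U_(ord_max) P@_0 X Y.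
Proof.
move=> l; apply/mpolyP => m.
rewrite /lin !mcoeffD !mcoeffZ !mcoeffX mcoeffC.
case: (posnP (mdeg m)) => [/eqP|m0].
  rewrite mdeg_eq0 => /eqP->; rewrite !mnm1_eq0 eqxx.
  by rewrite !mulr0 !add0r mulr1.
case: (leqP (mdeg m) 1) => m1.
  have /mdeg1P[i /eqP ->] : mdeg m == 1%N by rewrite eqn_leq m1.
  rewrite !eq_mnm1 mnm1_eq0.
  by case: (ord2P i) => -> /=; rewrite ?mulr0 ?mulr1 ?add0r ?addr0.
have dm k : (mdeg k < 2)%N -> (k == m) = false.
  by move=> lk; apply: contraTF lk => /eqP->; rewrite -leqNgt.
rewrite memN_msupp_eq0; last by apply: msize_mdeg_ge; apply: leq_trans m1.
by rewrite !dm ?mdeg1 // eq_sym dm ?mdeg0 // !mulr0 !addr0.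
Qed.

Lemma inverse_uniq F G G' : inverse F G -> inverse F G' -> G = G'.
Proof.
by move=> [_ GF] [FG' _]; rewrite -[G]endo_compF1 -FG' endo_compA GF endo_comp1F.
Qed.

Lemma unit_det_of_right_inverse (a b a' b' x y z t : A) :
  a * x + b * z = 1 -> a * y + b * t = 0 -> a' * x + b' * z = 0 -> a' * y + b' * t = 1 ->
  a * b' - b * a' \is a GRing.unit.
Proof.
move=> e1 e2 e3 e4; apply/unitrPr; exists (x * t - y * z).
transitivity ((a * x + b * z) * (a' * y + b' * t) - (a * y + b * t) * (a' * x + b' * z)).
  by ring.
by rewrite e1 e2 e3 e4 !mulr1 mulr0 subr0.
Qed.

Lemma affine_GA2 F : GA2 F -> affine F -> exists a b c a' b' c' : A,
  F = linmap a b c a' b' c' /\ a * b' - b * a' \is a GRing.unit.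
Proof.
move=> /GA2_inverse[G [_ GF]] Fa.
have := pair_eta F; rewrite (msize_le2_lin (Fa ord0)) (msize_le2_lin (Fa ord_max)).
set a := _@_U_(ord0); set b := _@_U_(ord_max); set c := _@_0.
set a' := _@_U_(ord0); set b' := _@_U_(ord_max); set c' := _@_0 => eF.
exists a, b, c, a', b', c'; split=> //.
move: GF; rewrite eF comp_linmap endo_idX => e.
have e0 := congr1 (fun t => tnth t ord0) e; have e1 := congr1 (fun t => tnth t ord_max) e.
rewrite !tnth_pair0 !tnth_pair1 {e} in e0 e1.
(* Coefficients of [X] and [Y] suffice: the linear part of [G] inverts the matrix on the right,
   without [G] being known to be affine. *)
have co i P Q (d d' d'' : A) R' : lin d d' d'' P Q = R' ->
    d * P@_U_(i) + d' * Q@_U_(i) = R'@_U_(i).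
  by move<-; rewrite /lin !mcoeffD !mcoeffZ mcoeffC mnm1_eq0 mulr0 addr0.
have := co ord0 _ _ _ _ _ _ e0; have := co ord_max _ _ _ _ _ _ e0.
have := co ord0 _ _ _ _ _ _ e1; have := co ord_max _ _ _ _ _ _ e1.
rewrite !mcoeffXU /= => h1 h2 h3 h4; exact: unit_det_of_right_inverse h4 h3 h2 h1.
Qed.

End Classification.

(** * Affine and triangular automorphisms *)

Section Triangular.
Variable A : idomainType.
Implicit Types (F G H : 2.-tuple {mpoly A[2]}) (P Q E D : {mpoly A[2]}).

Local Notation X := ('X_ord0 : {mpoly A[2]}).
Local Notation Y := ('X_ord_max : {mpoly A[2]}).

Lemma rmorph_mpoly_ext (S : comNzRingType) (f g : {rmorphism {mpoly A[2]} -> S}) :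
  (forall c, f c%:MP = g c%:MP) -> (forall i, f 'X_i = g 'X_i) -> f =1 g.
Proof.
move=> fgC fgX P; rewrite (mpolyE P) !rmorph_sum; apply: eq_bigr => m _.
rewrite -mul_mpolyC mpolyXE_id !rmorphM fgC !rmorph_prod; congr (_ * _).
by apply: eq_bigr => i _; rewrite !rmorphXn fgX.
Qed.

(* A[X, Y] seen as A[Y][X]: 'X stands for X in the outer ring, for Y in the inner one. *)
Definition poly2_of : {mpoly A[2]} -> {poly {poly A}} :=
  mmap (polyC \o polyC) (fun i => if i == ord0 then 'X else 'X%:P).

HB.instance Definition _ := GRing.RMorphism.on poly2_of.

Definition mpoly_of : {poly {poly A}} -> {mpoly A[2]} :=
  horner_eval X \o map_poly (horner_eval Y \o map_poly (@mpolyC 2 A)).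

HB.instance Definition _ := GRing.RMorphism.on mpoly_of.

Lemma poly2_ofC c : poly2_of c%:MP = c%:P%:P.
Proof. exact: mmapC. Qed.

Lemma poly2_ofX i : poly2_of 'X_i = if i == ord0 then 'X else 'X%:P.
Proof. by rewrite /poly2_of mmapX mmap1U. Qed.

Lemma poly2_ofK : cancel poly2_of mpoly_of.
Proof.
apply: (@rmorph_mpoly_ext _ (mpoly_of \o poly2_of) idfun) => [c|i] /=.
  by rewrite poly2_ofC /mpoly_of /= map_polyC /= /horner_eval hornerC map_polyC hornerC.
rewrite poly2_ofX; case: (ord2P i) => -> /=.
  by rewrite /mpoly_of /= map_polyX /horner_eval hornerX.
by rewrite /mpoly_of /= map_polyC /= /horner_eval hornerC map_polyX hornerX.
Qed.

(** An endomorphism fixing [Y] is one of the A[Y]-algebra A[Y][X], hence a composition of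
    polynomials in X. *)
Lemma poly2_of_endo G P : tnth G ord_max = Y ->
  poly2_of (endo G P) = poly2_of P \Po poly2_of (tnth G ord0).
Proof.
move=> GY; move: P.
apply: (@rmorph_mpoly_ext _ (poly2_of \o comp_mpoly G)
         (comp_poly (poly2_of (tnth G ord0)) \o poly2_of)) => [c|i] /=.
  by rewrite comp_mpolyC !poly2_ofC comp_polyC.
rewrite -[_ \mPo _]/(endo G 'X_i); case: (ord2P i) => ->.
  by rewrite endo_X0 [in RHS]poly2_ofX eqxx comp_polyX.
by rewrite endo_X1 GY [in RHS]poly2_ofX poly2_ofX /= comp_polyC.
Qed.

(** The inverse fixes [Y] too, so two polynomials in X over A[Y] compose to X. Both have degree 1,
    and the leading coefficient is a unit of A[Y], that is, a constant unit. *)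
Lemma triangular_GA2_Y P : GA2 [tuple P; Y] ->
  exists (w : A) (p : {poly A}), w \is a GRing.unit /\ P = w *: X + pev p Y.
Proof.
move=> /GA2_inverse[G []].
rewrite {1}[G]pair_eta endo_comp_pair endo_idX => FG GF.
have GY : tnth G ord_max = Y.
  by have := congr1 (fun t => tnth t ord_max) GF; rewrite endo_comp_pair endo_X1.
have := congr1 (fun t => tnth t ord0) GF; rewrite endo_comp_pair !tnth_pair0 => e.
have := poly2_of_endo P GY; rewrite e poly2_ofX eqxx.
set f := poly2_of P; set g := poly2_of _ => fg.
have := size_comp_poly f g; rewrite -fg size_polyX /=.
move=> /esym/eqP; rewrite muln_eq1 => /andP[/eqP sf /eqP sg].
have sg1 : (1 < size g)%N by move: sg; case: (size g) => [|[|]].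
have := lead_coef_comp f sg1; rewrite -fg lead_coefX sf expr1 lead_coefE sf => fg1.
have : f`_1 \is a GRing.unit by apply/unitrPr; exists (lead_coef g).
rewrite poly_unitE => /andP[/eqP sf1 uw].
exists f`_1`_0, f`_0; split=> //.
rewrite -[LHS](poly2_ofK P) -/f {1}(_ : f = f`_1 *: 'X + (f`_0)%:P).
  rewrite rmorphD /= /mpoly_of /= map_polyZ map_polyX map_polyC.
  rewrite /horner_eval hornerZ hornerX hornerC.
  rewrite -[LHS]/(pev f`_1 Y * X + pev f`_0 Y).
  by rewrite {1}(size1_polyC (eq_leq sf1)) pevC mul_mpolyC.
apply/polyP=> -[|[|i]]; rewrite coefD coefZ coefX coefC ?mulr0 ?add0r ?mulr1 ?addr0 //.
by rewrite nth_default //; move: sf; case: (size f) => // n /= ->.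
Qed.

Lemma triangular_pev F : triangular F -> exists f : {poly A}, tnth F ord_max = pev f Y.
Proof.
move=> tF; set P := tnth F _ in tF *.
exists (\sum_(m <- msupp P) P@_m *: 'X^(m ord_max)).
rewrite (big_morph (fun p => pev p Y) (fun p q => pevD p q Y) (pev0 Y)) {1}(mpolyE P).
rewrite !big_seq; apply: eq_bigr => m /tF m0.
rewrite pevZ pevXn pevX mpolyXE_id big_ord_recl big_ord1 m0 expr0 mul1r.
by congr (_ *: 'X__ ^+ m _); apply: val_inj.
Qed.

Lemma msize_pev_const (p : {poly A}) E : (msize E <= 1)%N -> (msize (pev p E) <= 1)%N.
Proof.
move=> /msize1_polyC ->; move: (_@_0) => c.
elim/poly_ind: p => [|p d IH]; first by rewrite pev0 msize0.
rewrite pevD pevMX pevC (msize1_polyC IH) -mpolyCM -mpolyCD msizeC.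
by case: (_ != 0).
Qed.

(** The inverse gives f(E) = Y, where f(Y) is the second component; degrees force f = u Y + v with
    [u] a unit. Undoing this substitution by [B] leads to the case of an automorphism fixing [Y]. *)
Lemma triangular_GA2 F : GA2 F -> triangular F -> exists (w u v : A) (p : {poly A}),
  [/\ w \is a GRing.unit, u \is a GRing.unit & F = endo_comp (elem p) (linmap w 0 0 0 u v)].
Proof.
move=> FGA /triangular_pev[f Ff]; have [G [FG GF]] := GA2_inverse FGA.
have := congr1 (fun t => tnth t ord_max) GF.
rewrite {1}[F]pair_eta endo_comp_pair endo_idX !tnth_pair1 Ff endo_pev endo_X1.
set E := tnth G ord_max => fE.
have sY : msize Y = 2%N by rewrite msizeX mdeg1.
have lE : (1 < msize E)%N.
  by rewrite ltnNge; apply/negP => /(@msize_pev_const f); rewrite fE sY.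
have f0 : f != 0 by apply: contra_eq_neq fE => ->; rewrite pev0 eq_sym -msize_poly_eq0 sY.
have := msize_pev lE f0; rewrite fE sY => -[] /esym/eqP.
rewrite muln_eq1 => /andP[/eqP sf _].
have sf2 : (size f <= 2)%N by move: sf; case: (size f) => // n /= ->.
move: fE; rewrite pev_size2 // => fE.
have uu : f`_1 \is a GRing.unit.
  apply/unitrPr; exists (E@_U_(ord_max)).
  have := congr1 (mcoeff U_(ord_max)) fE.
  by rewrite mcoeffD mcoeffZ mcoeffC mnm1_eq0 mulr0 addr0 mcoeffXU eqxx.
pose u := f`_1; pose v := f`_0.
pose B := linmap 1 0 0 0 u^-1 (- (v / u)) : 2.-tuple {mpoly A[2]}.
pose B' := linmap 1 0 0 0 u v : 2.-tuple {mpoly A[2]}.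
have BB' : inverse B B'.
  split; rewrite comp_linmap /= !lin_lin endo_idX.
    rewrite !(mul0r, mul1r, mulr0, addr0, add0r) lin10 mulrV // mulrN mulrCA mulrV //.
    by rewrite mulr1 addNr lin01.
  rewrite !(mul0r, mul1r, mulr0, addr0, add0r) lin10 mulVr //.
  by rewrite mulrC addrN lin01.
have FB : endo_comp F B = [tuple tnth F ord0; Y].
  rewrite comp_linmap lin10 Ff pev_size2 // -/u -/v; congr [tuple _; _].
  rewrite /lin scale0r add0r scalerDr scalerA mulVr // scale1r -addrA.
  by rewrite -mul_mpolyC -mpolyCM mulrC -mpolyCD addrN mpolyC0 addr0.
have : GA2 (endo_comp F B) := inverse_GA2 (inverse_comp (conj FG GF) BB').
rewrite FB => /triangular_GA2_Y[w [p [uw ePw]]].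
exists w, u, v, (w^-1 *: p); split=> //.
rewrite comp_linmap tnth_pair0 tnth_pair1 [LHS]pair_eta ePw Ff (pev_size2 _ sf2).
congr [tuple _; _].
  by rewrite /lin scale0r mpolyC0 !addr0 pevZ scalerDr scalerA mulrV ?scale1r.
by rewrite /lin scale0r add0r.
Qed.

End Triangular.

(** * Tame automorphisms are reduced *)

Section TameReduced.
Variable A : idomainType.
Implicit Types (F G H : 2.-tuple {mpoly A[2]}) (P Q E D : {mpoly A[2]}).

Local Notation X := ('X_ord0 : {mpoly A[2]}).
Local Notation Y := ('X_ord_max : {mpoly A[2]}).

Lemma linmap_inverse (a b c a' b' c' : A) : a * b' - b * a' \is a GRing.unit ->
  exists x y z x' y' z' : A, x * y' - y * x' \is a GRing.unit /\
    inverse (linmap a b c a' b' c') (linmap x y z x' y' z').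
Proof.
set d := a * b' - _ => du.
(* Cramer's rule; the new translation is minus the inverse matrix applied to ([c], [c']). *)
exists (b' * d^-1), (- b * d^-1), ((b * c' - b' * c) * d^-1).
exists (- a' * d^-1), (a * d^-1), ((a' * c - a * c') * d^-1); split.
  rewrite [X in X \is a _](_ : _ = d * d^-1 * d^-1); last first.
    by move: (d^-1) => e; rewrite /d; ring.
  by rewrite mulrV // mul1r unitrV.
have de : d * d^-1 = 1 by rewrite mulrV.
split; rewrite comp_linmap /= !lin_lin endo_idX; congr [tuple _; _].
- rewrite -[RHS](lin10 X Y); congr lin.
  + by rewrite -de; move: (d^-1) => e; rewrite /d; ring.
  + by move: (d^-1) => e; ring.
  + by move: (d^-1) => e; ring.
- rewrite -[RHS](lin01 X Y); congr lin.
  + by move: (d^-1) => e; ring.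
  + by rewrite -de; move: (d^-1) => e; rewrite /d; ring.
  + by move: (d^-1) => e; ring.
- rewrite -[RHS](lin10 X Y); congr lin.
  + by rewrite -de; move: (d^-1) => e; rewrite /d; ring.
  + by move: (d^-1) => e; ring.
  + transitivity (c * (1 - d * d^-1)); last by rewrite de subrr mulr0.
    by move: (d^-1) => e; rewrite /d; ring.
- rewrite -[RHS](lin01 X Y); congr lin.
  + by move: (d^-1) => e; ring.
  + by rewrite -de; move: (d^-1) => e; rewrite /d; ring.
  + transitivity (c' * (1 - d * d^-1)); last by rewrite de subrr mulr0.
    by move: (d^-1) => e; rewrite /d; ring.
Qed.

Lemma elem_inverse (p : {poly A}) : inverse (elem p) (elem (- p)).
Proof.
split; rewrite comp_elem tnth_pair0 tnth_pair1 endo_idX pevN; congr [tuple _; _].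
  by rewrite addrK.
by rewrite addrNK.
Qed.

Lemma linmap_TA2 (a b c a' b' c' : A) : a * b' - b * a' \is a GRing.unit ->
  TA2 (linmap a b c a' b' c').
Proof.
move=> /(@linmap_inverse a b c a' b' c')[x [y [z [x' [y' [z' [_ inv]]]]]]].
apply: TA2_affine; first exact: inverse_GA2 inv.
by move=> i; case: (ord2P i) => ->; apply: msize_linXY.
Qed.

Lemma elem_TA2 (p : {poly A}) : TA2 (elem p).
Proof.
apply: TA2_triangular; first exact: inverse_GA2 (elem_inverse p).
move=> m; rewrite tnth_pair1 msuppX inE => /eqP->.
by rewrite mnm1E.
Qed.

Definition reduced_pair F := reduced (tnth F ord0) (tnth F ord_max).

Lemma reduced_comp_linmap F (a b c a' b' c' : A) : a * b' - b * a' \is a GRing.unit ->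
  reduced_pair F -> reduced_pair (endo_comp F (linmap a b c a' b' c')).
Proof. by move=> u r; rewrite comp_linmap; apply: reduced_lin. Qed.

Lemma reduced_pair_comp_elem F p :
  reduced_pair F -> reduced_pair (endo_comp F (elem p)).
Proof. by move=> r; rewrite comp_elem; apply: reduced_comp_elem. Qed.

(* The inverse is carried along because TA2 is closed under inversion. *)
Lemma TA2_reduced_comp G : TA2 G -> exists G',
  [/\ inverse G G', forall F, reduced_pair F -> reduced_pair (endo_comp F G)
   & forall F, reduced_pair F -> reduced_pair (endo_comp F G')].
Proof.
elim=> {G} [G GGA Ga|G GGA Gt||G H _ [G' [iG rG rG']] _ [H' [iH rH rH']]
           |G H _ [G' [iG rG rG']] GH HG].
- have [a [b [c [a' [b' [c' [-> u]]]]]]] := affine_GA2 GGA Ga.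
  have [x [y [z [x' [y' [z' [u' inv]]]]]]] := linmap_inverse c c' u.
  exists (linmap x y z x' y' z'); split=> // F; exact: reduced_comp_linmap.
- have [w [u [v [p [uw uu ->]]]]] := triangular_GA2 GGA Gt.
  have uwu : w * u - 0 * 0 \is a GRing.unit by rewrite mul0r subr0 unitrM uw.
  have [x [y [z [x' [y' [z' [u' inv]]]]]]] := linmap_inverse 0 v uwu.
  exists (endo_comp (linmap x y z x' y' z') (elem (- p))); split.
  + exact: inverse_comp (elem_inverse p) inv.
  + by move=> F r; rewrite endo_compA; apply/reduced_comp_linmap/reduced_pair_comp_elem.
  + by move=> F r; rewrite endo_compA; apply/reduced_pair_comp_elem/reduced_comp_linmap.
- exists (endo_id A); split; first by split; rewrite endo_comp1F.
    by move=> F; rewrite endo_compF1.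
  by move=> F; rewrite endo_compF1.
- exists (endo_comp H' G'); split; first exact: inverse_comp.
    by move=> F r; rewrite endo_compA; apply/rH/rG.
  by move=> F r; rewrite endo_compA; apply/rG'/rH'.
(* By uniqueness of inverses [H] is [G'], for which the induction hypothesis provides the closure
   property. *)
- exists G; split=> //; first by rewrite (inverse_uniq (conj GH HG) iG).
Qed.

(** The identity is reduced, and right composition with a tame [F] preserves reduced pairs. *)
Lemma TA2_reduced F : TA2 F -> reduced_pair F.
Proof.
move=> /TA2_reduced_comp[F' [_ r _]]; rewrite -[F]endo_comp1F; apply: r.
rewrite /reduced_pair endo_idX tnth_pair0 tnth_pair1.
rewrite -[X in reduced X _](lin10 _ Y) -[X in reduced _ X](lin01 X).
by apply: reduced_affine; rewrite mul0r subr0 mulr1 unitr1.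
Qed.

End TameReduced.

(** * Localization and the local-global principle *)

Section PrimeIdeals.
Variable R : comNzRingType.

Definition proper_idealP (I : R -> Prop) : Prop :=
  [/\ I 0, ~ I 1 & forall a x y, I x -> I y -> I (a * x + y)].

Lemma maximal_ideal (I : R -> Prop) : proper_idealP I ->
  exists M : R -> Prop, [/\ proper_idealP M, forall x, I x -> M x
    & forall x, ~ M x -> exists m r, M m /\ m + r * x = 1].
Proof.
move=> [I0 I1 Ilin].
(* Zorn's lemma is applied to the [J] whose union with [I] is a proper ideal, so that the empty
   chain, with empty union, is bounded as well. *)
pose U (J : R -> Prop) x := I x \/ J x.
have [C subP tot|J [PJ maxJ]] := @classical_sets.Zorn_bigcup R (fun J => proper_idealP (U J)).
  split; first by left.
    by case=> // -[J CJ J1]; have [_ + _] := subP J CJ; apply; right.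
  move=> a x y [Ix|[J CJ Jx]] [Iy|[K CK Ky]].
  - by left; apply: Ilin.
  - have [_ _ lin] := subP K CK.
    have [] := lin a x y (or_introl Ix) (or_intror Ky); first by left.
    by right; exists K.
  - have [_ _ lin] := subP J CJ.
    have [] := lin a x y (or_intror Jx) (or_introl Iy); first by left.
    by right; exists J.
  - have [JK|KJ] := tot J K CJ CK.
      have [_ _ lin] := subP K CK.
      have [] := lin a x y (or_intror (JK _ Jx)) (or_intror Ky); first by left.
      by right; exists K.
    have [_ _ lin] := subP J CJ.
    have [] := lin a x y (or_intror Jx) (or_intror (KJ _ Ky)); first by left.
    by right; exists J.
exists (U J); split=> // [x Ix|x Mx]; first by left.
have [M0 M1 Mlin] := PJ.
(* The ideal generated by the maximal one and [x]; if it missed 1, it would contradict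
   maximality. *)
pose B z := exists m r, U J m /\ z = m + r * x.
have UB z : U B z -> B z.
  by case=> // Iz; exists z, 0; rewrite mul0r addr0; split=> //; left.
have Bx : B x by exists 0, 1; rewrite add0r mul1r.
have [[m [r [Mm e]]]|nB1] := pselect (B 1); first by exists m, r.
case: (maxJ B).
  split; last by move=> /(_ x Bx) Jx; apply: Mx; right.
  by move=> z Jz; exists z, 0; rewrite mul0r addr0; split=> //; right.
split; first by left.
  by move=> /UB.
move=> a y z /UB[m [r [Mm ->]]] /UB[m' [r' [Mm' ->]]]; right.
exists (a * m + m'), (a * r + r'); split; first exact: Mlin.
by ring.
Qed.

Lemma prime_ideal_above (I : R -> Prop) : proper_idealP I ->
  exists p : prime_idealr R, forall x, I x -> x \in p.
Proof.
move=> /maximal_ideal[M [[M0 M1 Mlin] IM Mmax]].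
pose p : {pred R} := fun x => `[< M x >].
have pI : idealr_closed p.
  split; [exact/asboolP|exact/asboolP|].
  by move=> a x y /asboolP Mx /asboolP My; apply/asboolP/Mlin.
have pP : prime_idealr_closed p.
  move=> u v /asboolP Muv; apply/orP.
  have [Mu|nMu] := pselect (M u); first by left; apply/asboolP.
  right; apply/asboolP; have [m [r [Mm e]]] := Mmax u nMu.
  (* Maximal ideals are prime: v = (m + r u) v = v m + r (u v). *)
  rewrite -[v]mul1r -e mulrDl [m * v]mulrC -mulrA.
  rewrite -[r * _]addr0; apply: (Mlin v m _ Mm); exact: Mlin.
pose i1 := isIdealr.Build R p pI; pose i2 := isPrimeIdealrClosed.Build R p pP.
pose q : prime_idealr R := HB.pack p i1 i2.
by exists q => x /IM Mx; apply/asboolP.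
Qed.

End PrimeIdeals.

(** * The localization at a prime as an integral domain *)

Section LocalRing.
Variables (R : idomainType) (p : prime_idealr R).
Implicit Types x y : at_prime p.

(** Units and inverses are chosen classically, to give [at_prime] the domain structure in which
    reduced pairs are studied. *)
Definition at_prime_unit : {pred at_prime p} := fun x => `[< exists y, y * x = 1 >].

Definition at_prime_inv x : at_prime p :=
  if pselect (exists y, y * x = 1) is left e then projT1 (cid e) else x.

Lemma at_prime_mulVr : {in at_prime_unit, left_inverse 1 at_prime_inv *%R}.
Proof.
move=> x /asboolP ux; rewrite /at_prime_inv; case: pselect => // e.
exact: (projT2 (cid e)).
Qed.

Lemma at_prime_unitP x y : y * x = 1 -> x \in at_prime_unit.
Proof. by move=> e; apply/asboolP; exists y. Qed.

Lemma at_prime_invr_out : {in [predC at_prime_unit], at_prime_inv =1 id}.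
Proof. by move=> x /asboolP ux; rewrite /at_prime_inv; case: pselect. Qed.

HB.instance Definition _ := GRing.ComNzRing_hasMulInverse.Build (at_prime p)
  at_prime_mulVr at_prime_unitP at_prime_invr_out.

Lemma at_prime_mulf_eq0 x y : x * y = 0 -> (x == 0) || (y == 0).
Proof.
move=> /(congr1 val)/eqP; rewrite rmorphM rmorph0 mulf_eq0 => /orP[] /eqP e.
- by apply/orP; left; apply/eqP/val_inj; rewrite e rmorph0.
- by apply/orP; right; apply/eqP/val_inj; rewrite e rmorph0.
Qed.

HB.instance Definition _ :=
  GRing.ComUnitRing_isIntegral.Build (at_prime p) at_prime_mulf_eq0.

Lemma to_local_subproof (r : R) : tofrac r \in at_prime_pred p.
Proof.
by apply/at_primeP; exists r, 1; rewrite notin_prime1 tofrac1 divr1.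
Qed.

Definition to_local (r : R) : at_prime p := AtPrime (to_local_subproof r).

Lemma to_local_zmod_morphism : zmod_morphism to_local.
Proof. by move=> r s; apply: val_inj; rewrite rmorphB /= tofracB. Qed.

Lemma to_local_monoid_morphism : monoid_morphism to_local.
Proof.
by split=> [|r s]; apply: val_inj; rewrite ?rmorph1 ?rmorphM /= (tofrac1, tofracM).
Qed.

HB.instance Definition _ :=
  GRing.isZmodMorphism.Build R (at_prime p) to_local to_local_zmod_morphism.
HB.instance Definition _ :=
  GRing.isMonoidMorphism.Build R (at_prime p) to_local to_local_monoid_morphism.

Lemma to_local_inj : injective to_local.
Proof. by move=> r s /(congr1 val) /= /eqP; rewrite tofrac_eq => /eqP. Qed.

Lemma to_local_eq0 r : (to_local r == 0) = (r == 0).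
Proof. by rewrite -(rmorph0 to_local) (inj_eq to_local_inj). Qed.

Lemma at_prime_frac x : exists (a s : R), s \notin p /\ x * to_local s = to_local a.
Proof.
have /at_primeP[a [s [sp e]]] := valP x; exists a, s; split=> //.
apply: val_inj; rewrite rmorphM /= e divrK // unitfE tofrac_eq0.
exact: notin_prime_neq0 sp.
Qed.

Lemma to_local_unit s : s \notin p -> to_local s \is a GRing.unit.
Proof.
move=> sp; have fs : (tofrac s)^-1 \in at_prime_pred p.
  by apply/at_primeP; exists 1, s; rewrite tofrac1 div1r.
apply/unitrPr; exists (AtPrime fs); apply: val_inj; rewrite rmorphM rmorph1 /= divrr //.
by rewrite unitfE tofrac_eq0; apply: notin_prime_neq0 sp.
Qed.

End LocalRing.
Arguments to_local {R} p r.

(** * A domain is the intersection of its localizations *)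

Section LocalGlobal.
Variable R : idomainType.

(** The [t] with [t * r] in the ideal generated by [s] form an ideal. Were it proper, it would lie
    in some prime [p], yet a denominator of the local quotient at [p] belongs to it. *)
Lemma local_global_dvd (r s : R) :
  (forall p : prime_idealr R, exists c : at_prime p, c * to_local p s = to_local p r) ->
  exists c, c * s = r.
Proof.
move=> loc; pose I t := exists c, c * s = t * r.
have [[c e]|nI] := pselect (I 1); first by exists c; rewrite e mul1r.
have /prime_ideal_above[p Ip] : proper_idealP I.
  split=> //; first by exists 0; rewrite !mul0r.
  move=> a x y [c e] [d f]; exists (a * c + d).
  by transitivity (a * (c * s) + d * s); [ring | rewrite e f; ring].
have [c e] := loc p; have [a [t [tp f]]] := at_prime_frac c.
case/negP: tp; apply: Ip; exists a; apply: (@to_local_inj _ p).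
by rewrite !rmorphM /= -f -e; ring.
Qed.

(** The zero ideal of a domain is proper. One prime is enough to read off degrees, which do not
    change under localization. *)
Lemma prime_ideal_exists : exists p : prime_idealr R, True.
Proof.
have [|p _] := @prime_ideal_above R (fun x => x = 0); last by exists p.
split=> //; first by apply/eqP; rewrite oner_eq0.
by move=> a x y -> ->; rewrite mulr0 addr0.
Qed.

End LocalGlobal.

(** * Extension of scalars along an injective morphism *)

Section ScalarExtension.
Variables (A B : comNzRingType) (f : {rmorphism A -> B}).
Hypothesis f_inj : injective f.
Implicit Types (F G : 2.-tuple {mpoly A[2]}) (P Q : {mpoly A[2]}).

Definition tuple_map F : 2.-tuple {mpoly B[2]} := [tuple of map (map_mpoly f) F].

Lemma tnth_tuple_map F i : tnth (tuple_map F) i = map_mpoly f (tnth F i).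
Proof. exact: tnth_map. Qed.

Lemma tuple_map_pair P Q : tuple_map [tuple P; Q] = [tuple map_mpoly f P; map_mpoly f Q].
Proof. by rewrite [LHS]pair_eta !tnth_tuple_map. Qed.

Lemma map_mpoly_inj : injective (map_mpoly (n := 2) f).
Proof.
move=> P Q e; apply/mpolyP => m; apply: f_inj.
by rewrite -!mcoeff_map_mpoly e.
Qed.

Lemma tuple_map_inj : injective tuple_map.
Proof.
move=> F G e; apply: eq_from_tnth => i; apply: map_mpoly_inj.
by rewrite -!tnth_tuple_map e.
Qed.

Lemma msize_map P : msize (map_mpoly f P) = msize P.
Proof. by rewrite !msizeE (perm_big _ (msupp_map_mpoly P f_inj)). Qed.

Lemma map_endo F P : map_mpoly f (endo F P) = endo (tuple_map F) (map_mpoly f P).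
Proof. exact: map_mpoly_comp. Qed.

Lemma tuple_map_comp F G :
  tuple_map (endo_comp F G) = endo_comp (tuple_map F) (tuple_map G).
Proof.
apply: eq_from_tnth => i; rewrite tnth_tuple_map !tnth_mktuple map_endo.
by rewrite tnth_tuple_map.
Qed.

Lemma tuple_map_id : tuple_map (endo_id A) = endo_id B.
Proof. by apply: eq_from_tnth => i; rewrite tnth_tuple_map !tnth_mktuple map_mpolyX. Qed.

Lemma inverse_map F G : inverse F G -> inverse (tuple_map F) (tuple_map G).
Proof. by move=> [FG GF]; split; rewrite -tuple_map_comp ?FG ?GF tuple_map_id. Qed.

Lemma GA2_map F : GA2 F -> GA2 (tuple_map F).
Proof. by move=> /GA2_inverse[G /inverse_map/inverse_GA2]. Qed.

Lemma TA2_map F : TA2 F -> TA2 (tuple_map F).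
Proof.
elim=> {F} [F FGA Fa|F FGA Ft||F G _ IF _ IG|F G _ IF FG GF].
- apply: TA2_affine; first exact: GA2_map.
  by move=> i; rewrite tnth_tuple_map msize_map.
- apply: TA2_triangular; first exact: GA2_map.
  move=> m; rewrite tnth_tuple_map (perm_mem (msupp_map_mpoly _ f_inj)); exact: Ft.
- by rewrite tuple_map_id; apply: TA2_id.
- by rewrite tuple_map_comp; apply: TA2_comp.
- by apply: (TA2_inv IF); rewrite -tuple_map_comp ?FG ?GF tuple_map_id.
Qed.

Lemma TA2_image_map F : TA2_image f (tuple_map F) <-> TA2 F.
Proof.
by split=> [[G TG /tuple_map_inj->]|TF] //; exists F.
Qed.

Lemma map_lin a b c P Q :
  map_mpoly f (lin a b c P Q) = lin (f a) (f b) (f c) (map_mpoly f P) (map_mpoly f Q).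
Proof. by rewrite /lin !rmorphD /= !map_mpolyZ map_mpolyC. Qed.

End ScalarExtension.

Lemma tuple_map_map (A B C : comNzRingType) (f : {rmorphism A -> B}) (g : {rmorphism B -> C})
    (h : {rmorphism A -> C}) (F : 2.-tuple {mpoly A[2]}) : g \o f =1 h ->
  tuple_map g (tuple_map f F) = tuple_map h F.
Proof.
move=> gf; apply: eq_from_tnth => i; rewrite !tnth_tuple_map; apply/mpolyP => m.
rewrite !mcoeff_map_mpoly; exact: gf.
Qed.

Lemma mpoly_lift (A B : comNzRingType) (f : {rmorphism A -> B}) (P : {mpoly B[2]}) :
  (forall m, exists r, P@_m = f r) -> exists Q, P = map_mpoly f Q.
Proof.
move=> /(_ _)/cid-/all_sig[c cP].
exists (\sum_(m <- msupp P) c m *: 'X_[m]).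
rewrite {1}(mpolyE P) rmorph_sum /=; apply: eq_bigr => m _.
by rewrite map_mpolyZ map_mpolyX cP.
Qed.

(** * Descent of coefficients from the fraction field *)

Section LocalTame.
Variable R : idomainType.

Lemma tofrac_inj : injective (@tofrac R).
Proof. by move=> x y /eqP; rewrite tofrac_eq => /eqP. Qed.

Lemma TA2_image_local (p : prime_idealr R) (G : 2.-tuple {mpoly R[2]}) :
  TA2_image (val : at_prime p -> {fraction R}) (tuple_map (@tofrac R) G)
  <-> TA2 (tuple_map (to_local p) G).
Proof.
rewrite -(TA2_image_map (f := val : at_prime p -> {fraction R}) val_inj).
by rewrite (@tuple_map_map _ _ _ _ _ (@tofrac R)).
Qed.

Lemma tame_local_lift (F : 2.-tuple {mpoly {fraction R}[2]}) :
  (forall p : prime_idealr R, TA2_image (val : at_prime p -> {fraction R}) F) ->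
  exists G, F = tuple_map (@tofrac R) G.
Proof.
move=> loc; have lift P : (forall p : prime_idealr R, exists Q : {mpoly (at_prime p)[2]},
    P = map_mpoly (val : at_prime p -> {fraction R}) Q) -> exists Q, P = map_mpoly (@tofrac R) Q.
  move=> locP; apply: mpoly_lift => m.
  (* One prime writes the coefficient as r / s; since it lies in every localization, [s] divides [r]
     locally, hence in [R]. *)
  have [/= r [s [s0 e]]] : exists r s : R, s != 0 /\ P@_m * tofrac s = tofrac r.
    have [p _] := prime_ideal_exists R; have [Q ->] := locP p.
    have [r [s [sp /(congr1 val) e]]] := at_prime_frac Q@_m.
    by exists r, s; rewrite mcoeff_map_mpoly (notin_prime_neq0 sp).
  have [c cs] : exists c, c * s = r.
    apply: local_global_dvd => p; have [Q PQ] := locP p; exists Q@_m.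
    by apply: val_inj; rewrite rmorphM /= -e PQ mcoeff_map_mpoly.
  exists c; apply: (mulIf (x := tofrac s)); first by rewrite tofrac_eq0.
  by rewrite e -cs tofracM.
have tn i : exists Q, tnth F i = map_mpoly (@tofrac R) Q.
  by apply: lift => p; have [G _ ->] := loc p; exists (tnth G i); apply: tnth_map.
have [Q0 e0] := tn ord0; have [Q1 e1] := tn ord_max.
by exists [tuple Q0; Q1]; rewrite tuple_map_pair -e0 -e1 -pair_eta.
Qed.

End LocalTame.

(** * Modules and ideals with two generators *)

(* The ideal (a, b) is principal, witnessed by (a, b) = c (x, y) with (x, y)
   unimodular; when a or b is nonzero, c is then u a + v b. *)
Definition unimodular_ratio (A : comNzRingType) (a b : A) : Prop :=
  exists x y u v : A, u * x + v * y = 1 /\ y * a = x * b.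

Section EmbeddedModule.
Variables (R : idomainType) (M : lmodType R) (elt : M -> R) (a b : R).
Hypothesis elt_inj : injective elt.
Hypothesis eltD : {morph elt : m n / m + n}.
Hypothesis eltZ : forall r m, elt (r *: m) = r * elt m.
Hypothesis eltP : forall m, exists r t : R, elt m = r * a + t * b.
Hypothesis elt_onto : forall r t : R, exists m, elt m = r * a + t * b.
Hypothesis a0 : a != 0.

Local Open Scope quotient_scope.

(** Through [elt] the module is the ideal (a, b), which becomes (c) over the localization, with c =
    u a + v b. The isomorphism sends m / s to elt m / (c s). *)
Lemma locally_free_embedded :
  (forall p : prime_idealr R, unimodular_ratio (to_local p a) (to_local p b)) ->
  locally_free_rank1 M.
Proof.
move=> loc p; have [x [y [u [v [uv ya]]]]] := loc p.
pose c := u * to_local p a + v * to_local p b.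
have ac : to_local p a = x * c.
  by rewrite -[LHS]mul1r -uv mulrDl -[v * y * _]mulrA ya /c; ring.
have bc : to_local p b = y * c.
  transitivity ((u * x + v * y) * to_local p b); first by rewrite uv mul1r.
  by rewrite mulrDl -[u * x * _]mulrA -ya /c; ring.
have c0 : c != 0.
  by apply: contraNneq a0 => c0; rewrite -(to_local_eq0 p) ac c0 mulr0.
have genc (m : M) : exists z, z * c = to_local p (elt m).
  have [r [t ->]] := eltP m; exists (to_local p r * x + to_local p t * y).
  by rewrite rmorphD !rmorphM /= ac bc; ring.
have i0 (s : denominator p) : to_local p (denom_val s) != 0.
  by rewrite to_local_eq0 (notin_prime_neq0 (denomP s)).
(* The value at a class is the solution [z] for its chosen representative; [fE] and [fU] extend the
   equation to all representatives. *)
have fP (q : locmod p M) :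
    exists z, z * (c * to_local p (denom_val (repr q).2)) = to_local p (elt (repr q).1).
  have [z <-] := genc (repr q).1.
  exists (z / to_local p (denom_val (repr q).2)).
  by rewrite -mulrA [c * _]mulrC mulKr // to_local_unit ?denomP.
pose f q := projT1 (cid (fP q)).
have fE w : f (\pi_(locmod p M) w) * (c * to_local p (denom_val w.2)) = to_local p (elt w.1).
  have [s sp] := eqfrac_repr w; set w' := repr _ => e.
  have fw' : f (\pi_(locmod p M) w) * (c * to_local p (denom_val w'.2)) = to_local p (elt w'.1).
    exact: projT2 (cid (fP (\pi_(locmod p M) w))).
  have s0 : to_local p s != 0 by rewrite to_local_eq0 (notin_prime_neq0 sp).
  have /(mulfI s0) e' : to_local p s * (to_local p (denom_val w.2) * to_local p (elt w'.1))
       = to_local p s * (to_local p (denom_val w'.2) * to_local p (elt w.1)).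
    have := congr1 (fun m => to_local p (elt m)) e.
    by cbv beta; rewrite !eltZ !rmorphM.
  apply: (mulfI (i0 w'.2)); rewrite -e' -fw'; ring.
have fU w z : z * (c * to_local p (denom_val w.2)) = to_local p (elt w.1) ->
    f (\pi_(locmod p M) w) = z.
  by move=> e; apply: (mulIf (mulf_neq0 c0 (i0 w.2))); rewrite fE.
have f_lin z q q' : f (z *: q + q') = z * f q + f q'.
  move: q q'; elim/quotW => w; elim/quotW => w'.
  have -> : z *: \pi_(locmod p M) w + \pi_(locmod p M) w'
      = \pi_(locmod p M) (addfrac (at_prime_num z *: w.1, denomM (at_prime_den z) w.2) w').
    by rewrite pi_addfrac -(locmod_scale_pi _ (at_prime_numden z)).
  apply: fU; rewrite /= eltD !eltZ !rmorphD !rmorphM /=.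
  rewrite -!fE.
  have -> : to_local p (at_prime_num z) = z * to_local p (denom_val (at_prime_den z)).
    apply: val_inj; rewrite rmorphM /= at_prime_numden divrK // unitfE.
    exact: tofrac_denom_neq0.
  by ring.
pose i1 := GRing.isLinear.Build _ _ _ _ (f : locmod p M -> (at_prime p)^o) f_lin.
pose g : {linear locmod p M -> (at_prime p)^o} := HB.pack (f : locmod p M -> (at_prime p)^o) i1.
exists g; rewrite -[GRing.Linear.sort g]/(f : _ -> (at_prime p)^o).
have f_inj : injective f.
  elim/quotW => w; elim/quotW => w' e; apply/eqP/eqfracP; exists 1.
    exact: notin_prime1.
  rewrite !scale1r; apply: elt_inj; rewrite !eltZ.
  apply: (@to_local_inj _ p); rewrite !rmorphM /=.
  by rewrite -!fE e; ring.
(* As z c = (z u) a + (z v) b, a common denominator of [z u] and [z v] gives a fraction with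
   numerator in the ideal. *)
have f_surj z : exists q, f q = z.
  have [r1 [s1 [sp1 e1]]] := at_prime_frac (z * u).
  have [r2 [s2 [sp2 e2]]] := at_prime_frac (z * v).
  have [m em] := elt_onto (r1 * s2) (r2 * s1).
  exists (\pi_(locmod p M) (m, Denominator (notin_primeM sp1 sp2))).
  by apply: fU; rewrite /= em rmorphD !rmorphM /= -e1 -e2 /c; ring.
exists (fun z => projT1 (cid (f_surj z))) => q; last exact: projT2 (cid (f_surj q)).
by apply: f_inj; apply: projT2 (cid (f_surj (f q))).
Qed.

End EmbeddedModule.

(** * The ideal (a, b) as a module *)

Section TwoGeneratedIdeal.
Variables (R : idomainType) (a b : R).
Hypothesis a0 : a != 0.

Definition span2 : {pred R^o} := fun m => `[< exists r t : R, m = r * a + t * b >].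

Lemma span2P (m : R^o) : reflect (exists r t : R, m = r * a + t * b) (m \in span2).
Proof. exact: asboolP. Qed.

Lemma span2_submod : submod_closed span2.
Proof.
split; first by apply/span2P; exists 0, 0; rewrite !mul0r addr0.
move=> c m n /span2P[r [t ->]] /span2P[r' [t' ->]].
apply/span2P; exists (c * r + r'), (c * t + t').
by rewrite /GRing.scale /=; ring.
Qed.

HB.instance Definition _ := GRing.isSubmodClosed.Build R R^o span2 span2_submod.

Record ideal2 := Ideal2 { ideal2_val :> R^o; _ : ideal2_val \in span2 }.

HB.instance Definition _ := [isSub for ideal2_val].
HB.instance Definition _ := [Choice of ideal2 by <:].
HB.instance Definition _ := [SubChoice_isSubLmodule of ideal2 by <:].

Definition elt2 (m : ideal2) : R := ideal2_val m.

Lemma elt2_inj : injective elt2. Proof. exact: val_inj. Qed.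

Lemma elt2P (m : ideal2) : exists r t : R, elt2 m = r * a + t * b.
Proof. exact/span2P/(valP m). Qed.

Lemma elt2D m n : elt2 (m + n) = elt2 m + elt2 n.
Proof. by []. Qed.

Lemma elt2Z r m : elt2 (r *: m) = r * elt2 m.
Proof. by []. Qed.

Lemma elt2_0 : elt2 0 = 0.
Proof. by []. Qed.

Lemma elt2_sum (I : Type) (s : seq I) (F : I -> ideal2) :
  elt2 (\sum_(z <- s) F z) = \sum_(z <- s) elt2 (F z).
Proof. exact: (big_morph elt2 elt2D elt2_0). Qed.

Lemma ideal2_gen : exists m n : ideal2, elt2 m = a /\ elt2 n = b.
Proof.
have ha : (a : R^o) \in span2 by apply/span2P; exists 1, 0; rewrite mul1r mul0r addr0.
have hb : (b : R^o) \in span2 by apply/span2P; exists 0, 1; rewrite mul1r mul0r add0r.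
by exists (Ideal2 ha), (Ideal2 hb).
Qed.

Lemma ideal2_generated : generated_by_two ideal2.
Proof.
have [g [h [ga hb]]] := ideal2_gen; exists g, h => m.
have [r [t e]] := elt2P m; exists r, t; apply: elt2_inj.
by rewrite elt2D !elt2Z ga hb.
Qed.

Lemma ideal2_locally_free :
  (forall p : prime_idealr R, unimodular_ratio (to_local p a) (to_local p b)) ->
  locally_free_rank1 ideal2.
Proof.
apply: (locally_free_embedded elt2_inj elt2D elt2Z elt2P _ a0) => r t.
have [g [h [<- <-]]] := ideal2_gen.
by exists (r *: g + t *: h).
Qed.

(** Elements of an ideal satisfy e2 e1 - e1 e2 = 0, so a basis cannot contain two. It is not empty
    since [a] is nonzero, and its single element generates the ideal. *)
Lemma free_ideal2_principal : free_module ideal2 ->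
  exists c x y u v : R, [/\ c = u * a + v * b, a = x * c & b = y * c].
Proof.
move=> [B [Bfree Bspan]].
have [g [h [ga hb]]] := ideal2_gen.
have B1 e1 e2 : e1 \in B -> e2 \in B -> e1 = e2.
  move=> B1 B2; apply/eqP; apply: contraT => ne.
  have ne' : e2 != e1 by rewrite eq_sym.
  pose c (e : ideal2) : R := if e == e1 then elt2 e2 else - elt2 e1.
  have un : uniq [:: e1; e2] by rewrite /= inE ne.
  have sB : {subset [:: e1; e2] <= B} by move=> e; rewrite !inE => /orP[] /eqP->.
  have /(Bfree _ c un sB) c0 : \sum_(e <- [:: e1; e2]) c e *: e = 0.
    rewrite big_cons big_seq1 /c eqxx (negPf ne').
    by apply: elt2_inj; rewrite elt2D !elt2Z elt2_0; ring.
  have := c0 e1; have := c0 e2; rewrite !inE !eqxx orbT /c eqxx (negPf ne').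
  move=> /(_ isT)/eqP; rewrite oppr_eq0 => /eqP v1 /(_ isT) v2.
  by move: ne; rewrite -(inj_eq elt2_inj) v1 v2 eqxx.
have [e Be] : exists e, e \in B.
  have [[|e s] [d [sB eq]]] := Bspan g.
    by move: eq => /(congr1 elt2)/eqP; rewrite big_nil ga (negPf a0).
  by exists e; apply: sB; rewrite inE eqxx.
have spane m : exists r : R, elt2 m = r * elt2 e.
  have [s [d [sB ->]]] := Bspan m.
  exists (\sum_(z <- s) d z); rewrite elt2_sum mulr_suml !big_seq.
  by apply: eq_bigr => z zs; rewrite elt2Z (B1 z e) //; apply: sB.
have [x xe] := spane g; have [y ye] := spane h.
have [u [v uv]] := elt2P e.
by exists (elt2 e), x, y, u, v; split; rewrite -?xe -?ye.
Qed.

End TwoGeneratedIdeal.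

Lemma unimodular_ratio_global (R : idomainType) (a b : R) :
  (forall M : lmodType R, locally_free_rank1 M -> generated_by_two M -> free_module M) ->
  a != 0 ->
  (forall p : prime_idealr R, unimodular_ratio (to_local p a) (to_local p b)) ->
  unimodular_ratio a b.
Proof.
move=> H a0 loc.
have := H _ (ideal2_locally_free a0 loc) (ideal2_generated a b).
move=> /(free_ideal2_principal a0)[c [x [y [u [v [ec ea eb]]]]]].
exists x, y, u, v; split; last by rewrite ea eb; ring.
have c0 : c != 0 by apply: contraNneq a0 => c0; rewrite ea c0 mulr0.
by apply: (mulIf c0); rewrite mul1r {2}ec ea eb; ring.
Qed.

(** * From local to global tameness *)

Section TameExtension.
Variables (R A : idomainType) (f : {rmorphism R -> A}).
Hypothesis f_inj : injective f.
Variable G : 2.-tuple {mpoly R[2]}.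
Hypothesis tG : TA2 (tuple_map f G).

Local Notation P := (tnth G ord0).
Local Notation Q := (tnth G ord_max).
Local Notation m := (mlead P).

Lemma inj_neq0 r : r != 0 -> f r != 0.
Proof. by rewrite -(inj_eq f_inj) rmorph0. Qed.

(** The degree drop over [A] forces the coefficient at the leading monomial of [P] to vanish, which
    determines [c]. A solution [d] in [R] therefore maps to [c], and the drop descends along the
    injection. *)
Lemma tame_extension_gt : (msize Q < msize P)%N ->
  let k := ((msize P).-1 %/ (msize Q).-1)%N in
  P@_m != 0 /\ exists c : A, c * f (Q ^+ k)@_m = f P@_m /\
    (forall d, d * (Q ^+ k)@_m = P@_m -> (msize (P - d *: Q ^+ k)%R < msize P)%N).
Proof.
move=> lt k; have P0 : P != 0 by rewrite -msize_poly_eq0 -lt0n (leq_ltn_trans _ lt).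
have Pm : P@_m != 0 by rewrite mleadc_eq0.
split=> //; have := reduced_gt_msize (TA2_reduced tG).
rewrite !tnth_tuple_map !(msize_map f_inj) => /(_ lt)[c]; rewrite -/k -rmorphXn => ltc.
have lc : c * f (Q ^+ k)@_m = f P@_m.
  move: (ltc); rewrite -(mlead_deg P0) ltnS => /msize_mdeg_ge/memN_msupp_eq0/eqP.
  by rewrite mcoeffB mcoeffZ !mcoeff_map_mpoly subr_eq0 => /eqP.
exists c; split=> // d dP.
have s0 : f (Q ^+ k)@_m != 0.
  by apply: inj_neq0; apply: contraNneq Pm => s0; rewrite -dP s0 mulr0.
have -> : P - d *: Q ^+ k = P + (- d) *: Q ^+ k by rewrite scaleNr.
rewrite -(msize_map f_inj) rmorphD /= map_mpolyZ rmorphN scaleNr.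
rewrite (_ : f d = c) //; apply: (mulIf s0).
by rewrite lc -dP rmorphM.
Qed.

(** The coefficient at the leading monomial of [P] fixes the ratio of the eliminating pair, so any
    solution over [R] is proportional to the pair over [A], and the drop descends. *)
Lemma tame_extension_eq : (2 < msize P)%N -> msize P = msize Q ->
  P@_m != 0 /\ unimodular_ratio (f P@_m) (f Q@_m) /\
    (forall x y, y * P@_m = x * Q@_m -> (msize (y *: P - x *: Q)%R < msize P)%N).
Proof.
move=> lP ePQ; have P0 : P != 0 by rewrite -msize_poly_eq0; case: (msize P) lP.
have Pm : P@_m != 0 by rewrite mleadc_eq0.
split=> //; have := reduced_eq_msize (TA2_reduced tG).
rewrite !tnth_tuple_map !(msize_map f_inj) => /(_ lP ePQ)[x' [y' [u' [v' [uv' lt]]]]].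
have yx' : y' * f P@_m = x' * f Q@_m.
  move: (lt); rewrite -(mlead_deg P0) ltnS => /msize_mdeg_ge/memN_msupp_eq0/eqP.
  by rewrite mcoeffB !mcoeffZ !mcoeff_map_mpoly subr_eq0 => /eqP.
split; first by exists x', y', u', v'.
move=> x y yx; have fP0 := inj_neq0 Pm.
(* Otherwise [y'] would vanish too, against unimodularity. *)
have x'0 : x' != 0.
  apply/eqP => x'0; move: yx'; rewrite x'0 mul0r => /eqP; rewrite mulf_eq0 (negPf fP0) orbF.
  by move=> /eqP y'0; move/eqP: uv'; rewrite x'0 y'0 !mulr0 addr0 eq_sym oner_eq0.
(* Proportionality turns x' (y P - x Q) into x (y' P - x' Q), up to the embedding [f]. *)
have prop : x' * f y = f x * y'.
  by apply: (mulIf fP0); rewrite -mulrA -rmorphM yx rmorphM /= mulrCA -yx' mulrA.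
rewrite -(msize_map f_inj) -(msizeZ _ x'0) rmorphB /= !map_mpolyZ.
rewrite scalerBr !scalerA prop [x' * _]mulrC -!scalerA -scalerBr.
exact: leq_ltn_trans (msizeZ_le _ _) lt.
Qed.

End TameExtension.

(** * Lowering the degrees of a locally tame automorphism *)

Section LocalToGlobal.
Variable R : idomainType.
Implicit Types (G T : 2.-tuple {mpoly R[2]}) (P Q : {mpoly R[2]}).

Definition locally_tame G := forall p : prime_idealr R, TA2 (tuple_map (to_local p) G).

Lemma msize_map_local (p : prime_idealr R) P : msize (map_mpoly (to_local p) P) = msize P.
Proof. exact/msize_map/to_local_inj. Qed.

Lemma locally_tame_comp G T : TA2 T -> locally_tame G -> locally_tame (endo_comp G T).
Proof.
move=> tT tG p; rewrite (tuple_map_comp (@to_local_inj _ p)).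
by apply: TA2_comp (tG p) _; apply: TA2_map tT; apply: to_local_inj.
Qed.

Lemma TA2_compKr G T : TA2 T -> TA2 (endo_comp G T) -> TA2 G.
Proof.
move=> tT; have [T' [TT' T'T]] := TA2_inverse tT.
move=> /TA2_comp /(_ (TA2_inv tT TT' T'T)).
by rewrite -endo_compA TT' endo_compF1.
Qed.

(** The determinant is a unit in every localization, so it divides 1 in [R]. *)
Lemma affine_locally_tame G : affine G -> locally_tame G -> TA2 G.
Proof.
move=> Ga tG; have := pair_eta G.
rewrite (msize_le2_lin (Ga ord0)) (msize_le2_lin (Ga ord_max)).
move: (_@_U_(ord0)) (_@_U_(ord_max)) (_@_0) => a b c.
move: (_@_U_(ord0)) (_@_U_(ord_max)) (_@_0) => a' b' c'.
rewrite -/(linmap a b c a' b' c') => eG.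
have [e de] : exists e, e * (a * b' - b * a') = 1.
  apply: local_global_dvd => p.
  have pa : affine (tuple_map (to_local p) G).
    by move=> i; rewrite tnth_tuple_map msize_map_local.
  have [G' /inverse_GA2 GGA] := TA2_inverse (tG p).
  have [a1 [b1 [c1 [a2 [b2 [c2 []]]]]]] := affine_GA2 GGA pa.
  rewrite eG tuple_map_pair !map_lin !map_mpolyX => e u.
  have e0 := congr1 (fun t => tnth t ord0) e; have e1 := congr1 (fun t => tnth t ord_max) e.
  rewrite !tnth_pair0 !tnth_pair1 in e0 e1.
  have ea := congr1 (mcoeff U_(ord0)) e0; have eb := congr1 (mcoeff U_(ord_max)) e0.
  have ea' := congr1 (mcoeff U_(ord0)) e1; have eb' := congr1 (mcoeff U_(ord_max)) e1.
  rewrite !lin_X0 in ea ea'; rewrite !lin_X1 in eb eb'.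
  exists (a1 * b2 - b1 * a2)^-1.
  by rewrite rmorphB !rmorphM rmorph1 /= ea eb ea' eb' mulVr.
by rewrite eG; apply: linmap_TA2; apply/unitrPr; exists e; rewrite mulrC.
Qed.

Lemma locally_tame_step_gt G : locally_tame G ->
  (msize (tnth G ord_max) < msize (tnth G ord0))%N ->
  exists T, [/\ TA2 T, tnth (endo_comp G T) ord_max = tnth G ord_max
    & (msize (tnth (endo_comp G T) ord0) < msize (tnth G ord0))%N].
Proof.
move=> tG; set P := tnth G ord0; set Q := tnth G ord_max => lt.
pose k := ((msize P).-1 %/ (msize Q).-1)%N.
have loc p := tame_extension_gt (@to_local_inj _ p) (tG p) lt.
have [c cP] : exists c, c * (Q ^+ k)@_(mlead P) = P@_(mlead P).
  by apply: local_global_dvd => p; have [_ [c [e _]]] := loc p; exists c.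
have [p _] := prime_ideal_exists R; have [_ [_ [_ ltc]]] := loc p.
exists (elem (- (c *: 'X^k))); rewrite comp_elem tnth_pair0 tnth_pair1; split=> //.
  exact: elem_TA2.
rewrite pevN pevZ pevXn pevX; exact: ltc.
Qed.

Hypothesis locally_free_ideal_free :
  forall M : lmodType R, locally_free_rank1 M -> generated_by_two M -> free_module M.

(** The row (y, -x) that cancels the leading forms is unimodular over [R]; the Bezout coefficients
    complete it to a matrix of determinant 1. *)
Lemma locally_tame_step_eq G : locally_tame G ->
  (2 < msize (tnth G ord0))%N -> msize (tnth G ord0) = msize (tnth G ord_max) ->
  exists T, [/\ TA2 T, (msize (tnth (endo_comp G T) ord_max) <= msize (tnth G ord_max))%N
    & (msize (tnth (endo_comp G T) ord0) < msize (tnth G ord0))%N].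
Proof.
move=> tG; set P := tnth G ord0; set Q := tnth G ord_max => lP ePQ.
have loc p := tame_extension_eq (@to_local_inj _ p) (tG p) lP ePQ.
have [p _] := prime_ideal_exists R; have [Pm [_ lt]] := loc p.
have [x [y [u [v [uv yx]]]]] : unimodular_ratio P@_(mlead P) Q@_(mlead P).
  by apply: unimodular_ratio_global => // q; have [_ [+ _]] := loc q.
have du : y * v - - x * u \is a GRing.unit.
  by rewrite mulNr opprK mulrC addrC [x * u]mulrC uv unitr1.
exists (linmap y (- x) 0 u v 0); rewrite comp_linmap tnth_pair0 tnth_pair1 -/P -/Q.
split; first exact: linmap_TA2.
  have Z (d : R) S : msize S = msize Q -> (msize (d *: S) < (msize Q).+1)%N.
    by move=> <-; rewrite ltnS msizeZ_le.
  rewrite -ltnS /lin mpolyC0 addr0; apply: msizeD_lt; exact: Z.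
rewrite /lin mpolyC0 addr0 scaleNr; exact: lt.
Qed.

Lemma locally_tame_TA2 G : locally_tame G -> TA2 G.
Proof.
have [n] := ubnP (msize (tnth G ord0) + msize (tnth G ord_max)).
elim: n G => // n IH G; rewrite ltnS => ln tG.
have step T : TA2 T -> (msize (tnth (endo_comp G T) ord0) + msize (tnth (endo_comp G T) ord_max)
    < msize (tnth G ord0) + msize (tnth G ord_max))%N -> TA2 G.
  move=> tT lt; apply: (TA2_compKr tT); apply: IH; last exact: locally_tame_comp.
  exact: leq_trans lt ln.
have [lt|gt|eq] := ltngtP (msize (tnth G ord0)) (msize (tnth G ord_max)).
(* The swap of components reduces this case to the next one. *)
- pose S := linmap 0 1 0 1 0 0 : 2.-tuple {mpoly R[2]}.
  have tS : TA2 S by apply: linmap_TA2; rewrite mul0r mulr1 sub0r unitrN unitr1.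
  have eS : endo_comp G S = [tuple tnth G ord_max; tnth G ord0].
    by rewrite comp_linmap lin01 lin10.
  have := locally_tame_step_gt (locally_tame_comp tS tG).
  rewrite eS tnth_pair0 tnth_pair1 => /(_ lt)[T [tT e1 lt0]].
  apply: (step (endo_comp S T)); first exact: TA2_comp.
  by rewrite endo_compA eS e1 addnC ltn_add2l.
- have [T [tT e1 lt0]] := locally_tame_step_gt tG gt.
  by apply: (step T) => //; rewrite e1 ltn_add2r.
(* Two components of equal degree at most 1 form the affine base case. *)
- case: (leqP (msize (tnth G ord0)) 2) => l2.
    apply: affine_locally_tame => // i.
    by case: (ord2P i) => ->; rewrite -?eq.
  have [T [tT le1 lt0]] := locally_tame_step_eq tG l2 eq.
  by apply: (step T) => //; rewrite -ltnS -addSn ltnS leq_add.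
Qed.

End LocalToGlobal.

(** * From tameness to free modules *)

Section Shear.

(* The exponential of the locally nilpotent derivation sending X to a L^2 and
   Y to b L^2, where L = b X - a Y lies in its kernel. *)
Definition shear (A : comNzRingType) (a b : A) : 2.-tuple {mpoly A[2]} :=
  let L := lin b (- a) 0 'X_ord0 'X_ord_max in
  [tuple 'X_ord0 + a *: L ^+ 2; 'X_ord_max + b *: L ^+ 2].

Lemma shear_map (A B : comNzRingType) (f : {rmorphism A -> B}) (a b : A) :
  tuple_map f (shear a b) = shear (f a) (f b).
Proof.
by rewrite tuple_map_pair !rmorphD /= !map_mpolyZ !rmorphXn /= map_lin rmorphN rmorph0 !map_mpolyX.
Qed.

Variable A : idomainType.
Implicit Types a b : A.

Local Notation X := ('X_ord0 : {mpoly A[2]}).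
Local Notation Y := ('X_ord_max : {mpoly A[2]}).

Lemma shear_TA2 a b : unimodular_ratio a b -> TA2 (shear a b).
Proof.
move=> [x [y [u [v [uv yx]]]]]; pose c := u * a + v * b.
have ea : a = x * c by rewrite -[LHS]mul1r -uv mulrDl -[v * y * _]mulrA yx /c; ring.
have eb : b = y * c.
  transitivity ((u * x + v * y) * b); first by rewrite uv mul1r.
  by rewrite mulrDl -[u * x * _]mulrA -yx /c; ring.
(* In the coordinates U = u X + v Y and V = y X - x Y one has L = c V, so the shear is U + c^3 V^2
   with V fixed; then X = x U + v V and Y = y U - u V. *)
have -> : shear a b = endo_comp (endo_comp (linmap u v 0 y (- x) 0) (elem (c ^+ 3 *: 'X^2)))
    (linmap x v 0 y (- u) 0).
  rewrite comp_elem !tnth_pair0 !tnth_pair1 comp_linmap !tnth_pair0 !tnth_pair1.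
  rewrite pevZ pevXn pevX /shear.
  have one : 1 = (u * x + v * y)%:MP :> {mpoly A[2]} by rewrite uv mpolyC1.
  congr [tuple _; _]; rewrite -[X in X + _]mul1r one ea eb /lin -!mul_mpolyC
    !(mpolyCD, mpolyCN, mpolyCM, mpolyC0, rmorphXn (@mpolyC 2 A)) /=; ring.
have det : u * (- x) - v * y \is a GRing.unit.
  by rewrite mulrN -opprD uv unitrN unitr1.
apply: TA2_comp; last by apply: linmap_TA2; rewrite mulrN mulrC -mulrN.
by apply: TA2_comp; [apply: linmap_TA2 | apply: elem_TA2].
Qed.

(** The components have degree 2 with leading forms a L^2 and b L^2, so the unimodular pair given by
    [reduced_eq_msize] must be in the ratio a : b. *)
Lemma unimodular_of_shear a b : a != 0 -> b != 0 -> TA2 (shear a b) -> unimodular_ratio a b.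
Proof.
move=> a0 b0 /TA2_reduced; rewrite /reduced_pair /shear; set L := lin _ _ _ _ _.
have lL : msize L = 2%N by rewrite msize_linXY_eq2 // b0.
have L0 : L != 0 by rewrite -msize_poly_eq0 lL.
have lL2 : msize (L ^+ 2) = 3%N by rewrite expr2 msizeM ?lL.
have lX i : msize ('X_i : {mpoly A[2]}) = 2%N by rewrite msizeX mdeg1.
have lZ c d e : d != 0 -> msize (lin c e 0 X Y + d *: L ^+ 2) = 3%N.
  move=> d0; have ld : msize (d *: L ^+ 2) = 3%N by rewrite msizeZ.
  by rewrite addrC msizeDl ld // ltnS msize_linXY.
rewrite !tnth_pair0 !tnth_pair1 => /reduced_eq_msize.
have eX : msize (X + a *: L ^+ 2) = 3%N by rewrite -[X in X + _](lin10 X Y) lZ.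
have eY : msize (Y + b *: L ^+ 2) = 3%N by rewrite -[X in X + _](lin01 X Y) lZ.
rewrite eX eY => /(_ isT (erefl _))[x [y [u [v [uv lt]]]]].
exists x, y, u, v; split=> //; apply/eqP; rewrite -subr_eq0.
apply: contraTT lt => ne; rewrite -leqNgt -(lZ y _ (- x) ne) -/L.
have -> : lin y (- x) 0 X Y + (y * a - x * b) *: L ^+ 2
   = y *: (X + a *: L ^+ 2) - x *: (Y + b *: L ^+ 2).
  rewrite -[lin _ _ _ _ _]/(y *: X + - x *: Y + 0%:MP) mpolyC0 addr0.
  by rewrite -!mul_mpolyC !(mpolyCD, mpolyCN, mpolyCM); ring.
by [].
Qed.

End Shear.

Lemma unimodular_ratio_of_tame_local (R : idomainType) (a b : R) :
  (forall F : 2.-tuple {mpoly {fraction R}[2]}, GA2 F ->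
     (TA2_image (@tofrac R) F <->
      (forall p : prime_idealr R, TA2_image (val : at_prime p -> {fraction R}) F))) ->
  (forall p : prime_idealr R, unimodular_ratio (to_local p a) (to_local p b)) ->
  unimodular_ratio a b.
Proof.
move=> H loc; have [->|a0] := eqVneq a 0.
  by exists 0, 1, 0, 1; split; ring.
have [->|b0] := eqVneq b 0.
  by exists 1, 0, 1, 0; split; ring.
have tl p : TA2 (tuple_map (to_local p) (shear a b)).
  by rewrite shear_map; apply: shear_TA2 (loc p).
apply: unimodular_of_shear => //; apply/(TA2_image_map (@tofrac_inj R)).
apply/H; last by move=> p; apply/TA2_image_local.
(* That the shear is an automorphism over the fraction field follows from its tameness at a single
   prime. *)
have [p _] := prime_ideal_exists R; have [G /inverse_GA2] := TA2_inverse (tl p).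
move=> /(GA2_map (f := val : at_prime p -> {fraction R}) val_inj).
by rewrite (@tuple_map_map _ _ _ _ _ (@tofrac R)).
Qed.

(** * Locally free modules with two generators *)

Section FreeModule.
Variables (R : idomainType) (M : lmodType R).
Hypothesis loc : locally_free_rank1 M.

Local Open Scope quotient_scope.

(** The coordinate of [m] is the image of m / 1. The last clause says that some coordinate is a
    unit, as the numerator of a preimage of 1 shows. *)
Lemma local_coordinate (p : prime_idealr R) : exists iota : M -> at_prime p,
  [/\ {morph iota : m n / m + n >-> m + n},
      forall r m, iota (r *: m) = to_local p r * iota m,
      forall m, iota m = 0 -> exists2 u, u \notin p & u *: m = 0
    & exists m s, s \notin p /\ iota m = to_local p s].
Proof.
have [f f_bij] := loc p.
have scal r (w : M * denominator p) :
    \pi_(locmod p M) (r *: w.1, denomM (denom1 p) w.2)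
    = to_local p r *: \pi_(locmod p M) w.
  symmetry; apply: (locmod_scale_pi (x := to_local p r) w).
  by rewrite /= tofrac1 divr1.
have pi_eq (w w' : M * denominator p) : denom_val w'.2 *: w.1 = denom_val w.2 *: w'.1 ->
    \pi_(locmod p M) w = \pi_(locmod p M) w'.
  move=> e; apply/eqP/eqfracP; exists 1; first exact: notin_prime1.
  by rewrite e.
exists (fun m => f (\pi_(locmod p M) (m, denom1 p))); split=> [m n|r m|m fm|].
- have -> : \pi_(locmod p M) (m + n, denom1 p)
      = \pi_(locmod p M) (m, denom1 p) + \pi_(locmod p M) (n, denom1 p).
    rewrite -[RHS]/(locmod_add _ _) -pi_addfrac; apply: pi_eq.
    by rewrite /= !scale1r mul1r scale1r.
  by rewrite raddfD.
- have -> : \pi_(locmod p M) (r *: m, denom1 p) = to_local p r *: \pi_(locmod p M) (m, denom1 p).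
    by rewrite -scal; apply: pi_eq; rewrite /= mulr1.
  by rewrite linearZ.
- have : \pi_(locmod p M) (m, denom1 p) = 0.
    by apply: (bij_inj f_bij); rewrite fm raddf0.
  move=> /eqP/eqfracP[u up]; rewrite /= !scale1r scaler0 => e.
  by exists u.
- have [g _ fg] := f_bij; have := fg 1; elim/quotW: (g 1) => w fw.
  exists w.1, (denom_val w.2); split; first exact: denomP.
  have -> : \pi_(locmod p M) (w.1, denom1 p) = to_local p (denom_val w.2) *: \pi_(locmod p M) w.
    by rewrite -scal; apply: pi_eq; rewrite /= scale1r mul1r.
  by rewrite linearZ fw; apply: mulr1.
Qed.

(** Were the annihilator of [z] proper, it would lie in a prime [p]. There the coordinate of [z] is
    killed by a nonzero [u], hence is 0, and an element outside [p] annihilates [z]. *)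
Lemma locally_free_torsion_free u (z : M) : u != 0 -> u *: z = 0 -> z = 0.
Proof.
move=> u0 uz; pose I t := t *: z = 0.
have [/=|nI] := pselect (I 1); first by rewrite /I scale1r.
have /prime_ideal_above[p Ip] : proper_idealP I.
  split=> //; first by rewrite /I scale0r.
  by move=> a x y; rewrite /I scalerDl -scalerA => -> ->; rewrite scaler0 addr0.
have [iota [iD iZ i0 _]] := local_coordinate p.
have e0 : iota 0 = 0 by rewrite -(scale0r 0) iZ rmorph0 mul0r.
have /i0[w wp wz] : iota z = 0.
  apply/eqP; have := iZ u z; rewrite uz e0 => /esym/eqP.
  by rewrite mulf_eq0 to_local_eq0 (negPf u0).
by case/negP: wp; apply: Ip.
Qed.

Hypothesis gen : generated_by_two M.
Hypothesis ratio_global : forall a b : R,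
  (forall p : prime_idealr R, unimodular_ratio (to_local p a) (to_local p b)) ->
  unimodular_ratio a b.

(** A local coordinate turns the relations between [g] and [h] into those of an ideal (a, b). Once a
    : b is unimodular, [u *: g + v *: h] generates the module, and torsion-freeness makes it a
    basis. *)
Lemma free_of_unimodular_ratio : free_module M.
Proof.
have [g [h gh]] := gen; have [p _] := prime_ideal_exists R.
have [iota [iD iZ i0 [m0 [s0 [s0p im0]]]]] := local_coordinate p.
have [a1 [s1 [s1p e1]]] := at_prime_frac (iota g).
have [b1 [s2 [s2p e2]]] := at_prime_frac (iota h).
(* The coordinates of [g] and [h], multiplied by the common denominator [s1 * s2]. *)
pose a := a1 * s2; pose b := b1 * s1.
have rel r t : r * a + t * b = 0 -> r *: g + t *: h = 0.
  move=> e; have /i0[u up] : iota (r *: g + t *: h) = 0.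
    have i12 : to_local p s1 * to_local p s2 != 0.
      by rewrite mulf_neq0 // to_local_eq0;
        [apply: notin_prime_neq0 s1p|apply: notin_prime_neq0 s2p].
    apply: (mulIf i12); rewrite mul0r iD !iZ -(rmorph0 (to_local p)) -e.
    by rewrite rmorphD !rmorphM /= -e1 -e2; ring.
  exact/locally_free_torsion_free/(notin_prime_neq0 up).
have [x [y [u [v [uv yx]]]]] : unimodular_ratio a b.
  apply: ratio_global => q; have [iq [iqD iqZ _ [m [s [sq im]]]]] := local_coordinate q.
  have [r [t em]] := gh m; have us := to_local_unit sq.
  (* The coordinates at [q] satisfy the relation b g - a h = 0, and they are unimodular because [m],
     a combination of [g] and [h], has a unit coordinate. *)
  exists (iq g), (iq h), (to_local q r / to_local q s), (to_local q t / to_local q s).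
  split.
    by rewrite ![_ / _ * _]mulrAC -mulrDl -!iqZ -iqD -em im divrr.
  have /(congr1 iq) : b *: g + (- a) *: h = 0 by apply: rel; ring.
  have -> : iq 0 = 0 by rewrite -(scale0r 0) iqZ rmorph0 mul0r.
  rewrite iqD !iqZ rmorphN mulNr => /eqP; rewrite subr_eq0 => /eqP e.
  by rewrite mulrC -e mulrC.
pose e := u *: g + v *: h.
have ge : g = x *: e.
  apply/eqP; rewrite -subr_eq0; apply/eqP.
  transitivity ((1 - x * u) *: g + (- (x * v)) *: h).
    by rewrite /e scalerDr !scalerA scalerBl scale1r scaleNr opprD addrA.
  apply: rel; transitivity (a * (1 - (u * x + v * y)) + v * (y * a - x * b)); first by ring.
  by rewrite uv yx !subrr !mulr0 addr0.
have he : h = y *: e.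
  apply/eqP; rewrite -subr_eq0; apply/eqP.
  transitivity ((- (y * u)) *: g + (1 - y * v) *: h).
    rewrite /e scalerDr !scalerA scalerBl scale1r scaleNr opprD.
    by rewrite addrCA.
  apply: rel; transitivity (b * (1 - (u * x + v * y)) - u * (y * a - x * b)); first by ring.
  by rewrite uv yx !subrr !mulr0 subr0.
have span m : exists r, m = r *: e.
  have [r [t ->]] := gh m; exists (r * x + t * y).
  by rewrite {1}ge {1}he !scalerA scalerDl.
have e0 : e != 0.
  apply: contraTneq (notin_prime_neq0 s0p) => e0; have [r em] := span m0.
  rewrite negbK -(to_local_eq0 p) -im0 em e0 scaler0.
  by rewrite -(scale0r 0) iZ rmorph0 mul0r.
exists (fun z => z == e); split=> [s c us sB sum0 z zs|m]; last first.
  have [r ->] := span m; exists [:: e], (fun=> r); rewrite big_seq1; split=> // z.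
  by rewrite inE => /eqP->; apply: eqxx.
have ze : z = e by apply/eqP/(sB z zs).
have e_s : s = [:: e].
  apply/perm_small_eq; rewrite ?size_seq1 //; apply: uniq_perm => // w; rewrite inE.
  by apply/idP/eqP => [/sB/eqP|->]; rewrite // -ze.
move: sum0; rewrite e_s big_seq1 ze => ce; apply/eqP; apply: contraTT e0 => c0.
by rewrite negbK; apply/eqP/(locally_free_torsion_free c0).
Qed.

End FreeModule.

Theorem theorem3 (R : idomainType) :
  (forall F : 2.-tuple {mpoly {fraction R}[2]}, GA2 F ->
     (TA2_image (@tofrac R) F <->
      (forall p : prime_idealr R, TA2_image (val : at_prime p -> {fraction R}) F)))
  <->
  (forall M : lmodType R,
     locally_free_rank1 M -> generated_by_two M -> free_module M).
Proof.
split=> [H M loc gen|H F FGA].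
  apply: (free_of_unimodular_ratio loc gen) => a b.
  exact: unimodular_ratio_of_tame_local.
split=> [[G tG ->] p|tF].
  by apply/TA2_image_local/TA2_map => //; apply: to_local_inj.
(* The components have coefficients in every localization, so the descent takes place over [R]. *)
have [G eG] := tame_local_lift tF; move: tF; rewrite eG => tF.
apply/(TA2_image_map (@tofrac_inj R)); apply: locally_tame_TA2 => // p.
exact/TA2_image_local.
Qed.
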